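(* Let $a>0$. For the interval $\Omega=(-a,a)$, if $\alpha\to\infty$ in a sector of the form $T_\varphi^-$ for any $\varphi\in(0,\pi/2)$, then for any $\theta\in(0,\pi-2\varphi)$ there are exactly two divergent eigenvalues of the Robin Laplacian in the sector $\mathbb{C}\setminus T_\theta^+$; these satisfy the asymptotics $$\lambda(\alpha)=-\alpha^2+\mathcal{O}\left(\alpha^2\mathrm{e}^{2a\operatorname{Re}\alpha}\right)$$ as $\alpha\to\infty$ in $T_\varphi^-$. If $\alpha\to\infty$ in such a way that $\operatorname{Re}\alpha$ remains bounded from below, then the Robin Laplacian has no divergent eigenvalues in $\mathbb{C}\setminus T_\theta^+$, for any $\theta>0$.
   Context: For $\alpha\in\mathbb{C}$, the Robin eigenvalue problem on $(-a,a)$ is $-u''=\lambda u$ on $(-a,a)$, $-u'(-a)+\alpha u(-a)=0$, $u'(a)+\alpha u(a)=0$. For $0<\theta<\pi$, $T_\theta^+:=\{z\in\mathbb{C}:|\arg z|<\theta\}$ and $T_\theta^-:=-T_\theta^+$, where the principal argument lies between $-\pi$ and $\pi$. The eigenvalues $\lambda(\alpha)$ depend analytically on $\alpha$ (away from crossings), and a divergent eigenvalue is one with $|\lambda(\alpha)|\to\infty$ as $\alpha\to\infty$ in the given manner. *)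

(* Defs.v *)
From Stdlib Require Import Reals Lra.
From Coquelicot Require Import Coquelicot.

Open Scope R_scope.

(** ** The Robin problem on [(-a, a)] *)

(* [u] is a classical solution, of class C^1 on [-a, a] and twice differentiable
   inside.  Since [u'] is continuous on the closed interval, its values at
   [-a] and [a] are the one-sided derivatives of [u] there; nothing is assumed
   about [u] and [u'] outside [-a, a]. *)
Record robin_eigenfunction (a : R) (alpha lambda : C) (u u' : R -> C) : Prop := {
  robin_continuous : continuous_on (fun x => -a <= x <= a) u;
  robin_continuous' : continuous_on (fun x => -a <= x <= a) u';
  robin_derive : forall x : R, -a < x < a -> is_derive u x (u' x);
  robin_equation : forall x : R, -a < x < a ->
    exists u''x : C, is_derive u' x u''x /\ Copp u''x = Cmult lambda (u x);
  robin_left : Cplus (Copp (u' (-a))) (Cmult alpha (u (-a))) = RtoC 0;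
  robin_right : Cplus (u' a) (Cmult alpha (u a)) = RtoC 0;
  robin_nonzero : exists x : R, -a < x < a /\ u x <> RtoC 0
}.

Definition robin_eigenvalue (a : R) (alpha lambda : C) : Prop :=
  exists u u' : R -> C, robin_eigenfunction a alpha lambda u u'.

(** ** Sectors *)

Definition is_principal_arg (z : C) (t : R) : Prop :=
  z <> RtoC 0 /\ - PI < t <= PI /\ z = (Cmod z * cos t, Cmod z * sin t).

(* The origin has no argument, hence lies in no [sector_plus theta]. *)
Definition sector_plus (theta : R) (z : C) : Prop :=
  exists t : R, is_principal_arg z t /\ Rabs t < theta.

Definition sector_minus (theta : R) (z : C) : Prop :=
  sector_plus theta (Copp z).

(** ** Going to infinity in a given manner *)

(* A manner in which [alpha] goes to infinity is given by the set [A] of values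
   that [alpha] is allowed to take: a sector, a curve, a sequence, ... *)
Definition at_infinity (A : C -> Prop) (P : C -> Prop) : Prop :=
  exists M : R, forall alpha : C, A alpha -> M < Cmod alpha -> P alpha.

Definition unbounded (A : C -> Prop) : Prop :=
  forall M : R, exists alpha : C, A alpha /\ M < Cmod alpha.

Global Instance at_infinity_filter (A : C -> Prop) : Filter (at_infinity A).
Proof.
constructor.
- now exists 0.
- intros P Q [M HP] [N HQ]; exists (Rmax M N); intros z Az Hz; split.
  + apply HP; [exact Az | exact (Rle_lt_trans _ _ _ (Rmax_l M N) Hz)].
  + apply HQ; [exact Az | exact (Rle_lt_trans _ _ _ (Rmax_r M N) Hz)].
- intros P Q PQ [M HP]; exists M; intros z Az Hz; apply PQ, HP; assumption.
Qed.

Lemma at_infinity_proper (A : C -> Prop) :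
  unbounded A -> ProperFilter (at_infinity A).
Proof.
intros uA; constructor; [ | apply at_infinity_filter].
intros P [M HP]; destruct (uA M) as [z [Az Hz]]; exists z; auto.
Qed.

(** ** Divergent eigenvalues *)

(* A divergent eigenvalue in [S] is a curve [alpha |-> lambda alpha], of which
   only the values at large [alpha] in [A] matter.  Continuity is all that is
   required of it, so that crossings, where analyticity may fail, are allowed
   (for a discrete [A], continuity within [A] is no restriction). *)
Record divergent_eigenvalue (a : R) (A S : C -> Prop) (lambda : C -> C) : Prop := {
  divergent_eigen :
    at_infinity A (fun alpha => robin_eigenvalue a alpha (lambda alpha));
  divergent_in : at_infinity A (fun alpha => S (lambda alpha));
  divergent_continuous : at_infinity A (fun alpha =>
    filterlim lambda (within A (locally alpha)) (locally (lambda alpha)));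
  divergent_infinite :
    filterlim (fun alpha => Cmod (lambda alpha)) (at_infinity A)
      (Rbar_locally p_infty)
}.

Definition bigO_at_infinity (A : C -> Prop) (f : C -> C) (g : C -> R) : Prop :=
  exists K : R, at_infinity A (fun alpha => Cmod (f alpha) <= K * Rabs (g alpha)).

(* Main.v *)
Require Import Defs.
From Stdlib Require Import Reals Lra Lia Psatz ClassicalEpsilon.
From Coquelicot Require Import Coquelicot.

(** Write [lambda = - m ^ 2] with [Re m > 0].  Comparing the values at [- a] and [a] of the
    constants [(u' - m u) e^(m x)] and [(u' + m u) e^(- m x)], [lambda] is a Robin eigenvalue
    iff [m + alpha = s (m - alpha) e^(-2 a m)] for a sign [s].
    Outside the sector [T_theta^+] one has [Re m >= sin (theta / 2) |m|], so that for large [m]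
    the exponential beats the prefactor and forces [m] to be close to [- alpha]; this is
    impossible when [Re alpha] is bounded from below.  When [alpha] goes to infinity in
    [T_phi^-], each of the two equations is a contraction on the unit disk around [- alpha];
    its unique root there is analytic in [alpha], and squaring gives the two eigenvalues.
    A continuous eigenvalue cannot switch between them because they never meet and a
    truncated sector is connected. *)

(** The sign [s] is a parity: [s = 1] belongs to [cosh (m x)] and [s = -1] to [sinh (m x)], whence
    two eigenvalues. Both have the leading term [- alpha ^ 2] and differ only by an exponentially
    small relative amount, so asymptotics cannot separate or count them; the count rests on
    uniqueness of the root in the disk for each sign. The condition [theta < PI - 2 phi] says
    [sin (theta / 2) < cos phi]: for large [alpha], a root near [- alpha], where
    [|arg (- alpha)| < phi], then lies in the cone [|arg m| <= (PI - theta) / 2], which is where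
    [- m ^ 2] avoids [T_theta^+]. The error term comes from [lambda + alpha ^ 2 = - (m + alpha) (m -
    alpha)]: the localisation only bounds the first factor by 1, but reinserting it in the secular
    equation makes it of order [|alpha| e^(2 a Re alpha)]. *)

Lemma Cmod_le_components (z : C) : Cmod z <= Rabs (Re z) + Rabs (Im z).
Proof.
rewrite <- (sqrt_Rsqr (Rabs (Re z) + Rabs (Im z))).
- apply sqrt_le_1_alt; unfold Rsqr.
  assert (H := Rabs_pos (Re z)); assert (H' := Rabs_pos (Im z)).
  unfold Re, Im in *.
  rewrite <- (pow2_abs (fst z)), <- (pow2_abs (snd z)); nra.
- generalize (Rabs_pos (Re z)) (Rabs_pos (Im z)); lra.
Qed.

Lemma im_le_Cmod (z : C) : Rabs (Im z) <= Cmod z.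
Proof. exact (Rle_trans _ _ _ (Rmax_r _ _) (Rmax_Cmod z)). Qed.

Lemma Re_bounds (z : C) : - Cmod z <= Re z <= Cmod z.
Proof. apply Rabs_le_between, re_le_Cmod. Qed.

Lemma Cmod_minus_sym (z w : C) : Cmod (z - w) = Cmod (w - z).
Proof. rewrite <- Cmod_opp; f_equal; ring. Qed.

Lemma Cmod_triangle_inv (z w : C) : Cmod z - Cmod w <= Cmod (z - w).
Proof.
assert (H := Cmod_triangle (z - w) w).
replace (z - w + w)%C with z in H by ring; lra.
Qed.

(** * The complex exponential *)

Definition cexp (z : C) : C := (exp (Re z) * cos (Im z), exp (Re z) * sin (Im z)).

Lemma cexp_0 : cexp 0 = 1.
Proof. unfold cexp; simpl; rewrite exp_0, cos_0, sin_0; apply injective_projections; simpl; ring. Qed.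

Lemma cexp_plus (z w : C) : cexp (z + w) = (cexp z * cexp w)%C.
Proof.
unfold cexp, Cplus, Cmult; simpl; unfold Re, Im.
rewrite exp_plus, cos_plus, sin_plus.
apply injective_projections; simpl; ring.
Qed.

Lemma cexp_opp (z : C) : (cexp z * cexp (- z))%C = 1.
Proof. rewrite <- cexp_plus, <- cexp_0; f_equal; ring. Qed.

Lemma Cmod_cexp (z : C) : Cmod (cexp z) = exp (Re z).
Proof.
unfold Cmod, cexp; cbn [fst snd].
rewrite !Rpow_mult_distr, <- Rmult_plus_distr_l.
assert (H := sin2_cos2 (Im z)); rewrite !Rsqr_pow2, Rplus_comm in H.
rewrite H, Rmult_1_r; apply sqrt_pow2; left; apply exp_pos.
Qed.

Lemma cexp_neq_0 (z : C) : cexp z <> 0.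
Proof. apply Cmod_gt_0; rewrite Cmod_cexp; apply exp_pos. Qed.

(** * Derivatives of complex functions of a real variable *)

Lemma is_derive_C (u : R -> C) (x : R) (l : C) :
  is_derive u x l <->
  is_derive (fun t => Re (u t)) x (Re l) /\ is_derive (fun t => Im (u t)) x (Im l).
Proof.
split.
- intros H; split.
  + apply (filterdiff_ext_lin _ (fun y : R => fst (scal y l))); [ | reflexivity].
    apply (filterdiff_comp' u (fun z : R * R => fst z) x
             (fun y : R => scal y l) (fun z : R * R => fst z)); [exact H | ].
    apply filterdiff_linear, is_linear_fst.
  + apply (filterdiff_ext_lin _ (fun y : R => snd (scal y l))); [ | reflexivity].
    apply (filterdiff_comp' u (fun z : R * R => snd z) x
             (fun y : R => scal y l) (fun z : R * R => snd z)); [exact H | ].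
    apply filterdiff_linear, is_linear_snd.
- intros [H1 H2].
  assert (coords : forall z : C,
    plus (scal (Re z) ((1, 0) : C_R_NormedModule)) (scal (Im z) ((0, 1) : C_R_NormedModule)) = z).
  { intros [p q]; unfold Re, Im, scal, plus; simpl; unfold prod_scal, prod_plus; simpl.
    change ((p * 1 + q * 0, p * 0 + q * 1) = (p, q)); f_equal; ring. }
  rewrite <- (coords l).
  apply (is_derive_ext (fun t => plus (scal (Re (u t)) ((1, 0) : C_R_NormedModule))
                                      (scal (Im (u t)) ((0, 1) : C_R_NormedModule)))).
  + intros t; apply coords.
  + apply @is_derive_plus; apply @is_derive_scal_l; assumption.
Qed.

Lemma is_derive_Cmult (u v : R -> C) (x : R) (u' v' : C) :
  is_derive u x u' -> is_derive v x v' ->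
  is_derive (fun t => (u t * v t)%C) x (u' * v x + u x * v')%C.
Proof.
rewrite !is_derive_C; unfold Re, Im; simpl; intros [U1 U2] [V1 V2]; split.
- replace (_ - _ + _) with
    ((fst u' * fst (v x) + fst (u x) * fst v') - (snd u' * snd (v x) + snd (u x) * snd v'))
    by ring.
  apply (is_derive_minus (fun t => fst (u t) * fst (v t)) (fun t => snd (u t) * snd (v t)));
    apply @is_derive_mult; auto using Rmult_comm.
- replace (_ + _ + _) with
    ((fst u' * snd (v x) + fst (u x) * snd v') + (snd u' * fst (v x) + snd (u x) * fst v'))
    by ring.
  apply (is_derive_plus (fun t => fst (u t) * snd (v t)) (fun t => snd (u t) * fst (v t)));
    apply @is_derive_mult; auto using Rmult_comm.
Qed.

Lemma is_derive_Cplus (u v : R -> C) (x : R) (u' v' : C) :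
  is_derive u x u' -> is_derive v x v' ->
  is_derive (fun t => (u t + v t)%C) x (u' + v')%C.
Proof. intros U V; exact (is_derive_plus u v x u' v' U V). Qed.

Lemma is_derive_Cconst (c : C) (x : R) : is_derive (fun _ : R => c) x (RtoC 0).
Proof. exact (is_derive_const (V := C_R_NormedModule) c x). Qed.

Lemma is_derive_Cscal (c : C) (u : R -> C) (x : R) (u' : C) :
  is_derive u x u' -> is_derive (fun t => (c * u t)%C) x (c * u')%C.
Proof.
intros U; replace (c * u')%C with (0 * u x + c * u')%C by ring.
exact (is_derive_Cmult (fun _ => c) u x 0 u' (is_derive_Cconst c x) U).
Qed.

Lemma is_derive_cexp (c : C) (x : R) :
  is_derive (fun t : R => cexp (c * t)) x (c * cexp (c * x))%C.
Proof.
apply is_derive_C; destruct c as [p q]; unfold cexp, Re, Im; simpl.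
split; auto_derive; trivial; unfold Rminus; ring.
Qed.

(** The mean value theorem has no complex form; applying it to the real and the imaginary part
    separately costs the factor 2. *)
Lemma Cmod_diff_bound (h dh : R -> C) (D : R) :
  (forall t, is_derive h t (dh t)) -> (forall t, 0 <= t <= 1 -> Cmod (dh t) <= D) ->
  Cmod (h 1 - h 0) <= 2 * D.
Proof.
intros Hd HD.
assert (key : forall f df : R -> R, (forall t, is_derive f t (df t)) ->
  (forall t, 0 <= t <= 1 -> Rabs (df t) <= D) -> Rabs (f 1 - f 0) <= D).
{ intros f df Hf Hb.
  destruct (MVT_gen f 0 1 df) as [t [Ht E]].
  - intros t _; apply Hf.
  - intros t _; apply continuity_pt_filterlim, (ex_derive_continuous f); eexists; apply Hf.
  - rewrite E, Rminus_0_r, Rmult_1_r; apply Hb.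
    now rewrite Rmin_left, Rmax_right in Ht by lra. }
apply (Rle_trans _ _ _ (Cmod_le_components _)).
replace (2 * D) with (D + D) by ring; apply Rplus_le_compat.
- apply (key (fun t => Re (h t)) (fun t => Re (dh t))).
  + intros t; apply (is_derive_C h t (dh t)), Hd.
  + intros t Ht; exact (Rle_trans _ _ _ (re_le_Cmod _) (HD t Ht)).
- apply (key (fun t => Im (h t)) (fun t => Im (dh t))).
  + intros t; apply (is_derive_C h t (dh t)), Hd.
  + intros t Ht; exact (Rle_trans _ _ _ (im_le_Cmod _) (HD t Ht)).
Qed.

Lemma exp_le_compat (x y : R) : x <= y -> exp x <= exp y.
Proof. intros [L | ->]; [left; now apply exp_increasing | right; reflexivity]. Qed.

Lemma Cmod_cexp_scaled (w : C) (t : R) : 0 <= t <= 1 -> Cmod (cexp (w * t)) <= exp (Cmod w).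
Proof.
intros Ht; rewrite Cmod_cexp; apply exp_le_compat.
rewrite re_scal_r; assert (H := Re_bounds w); assert (H' := Cmod_ge_0 w); nra.
Qed.

Lemma cexp_lipschitz_0 (w : C) : Cmod (cexp w - 1) <= 2 * (Cmod w * exp (Cmod w)).
Proof.
assert (H := Cmod_diff_bound (fun t => cexp (w * t)) (fun t => (w * cexp (w * t))%C)
  (Cmod w * exp (Cmod w))).
cbv beta in H; rewrite Cmult_1_r, Cmult_0_r, cexp_0 in H; apply H.
- intros t; apply is_derive_cexp.
- intros t Ht; rewrite Cmod_mult; apply Rmult_le_compat_l; [apply Cmod_ge_0 | ].
  now apply Cmod_cexp_scaled.
Qed.

(** The remainder [e^(t w) - t w] has derivative [w (e^(t w) - 1)], which [cexp_lipschitz_0] bounds;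
    each use of [Cmod_diff_bound] contributes a factor 2. *)
Lemma cexp_taylor_1 (w : C) :
  Cmod (cexp w - 1 - w) <= 4 * (Cmod w ^ 2 * exp (Cmod w)).
Proof.
assert (H := Cmod_diff_bound (fun t => (cexp (w * t) + (- w) * t)%C)
  (fun t => (w * cexp (w * t) + (- w) * 1)%C)
  (2 * (Cmod w ^ 2 * exp (Cmod w)))).
cbv beta in H; rewrite !Cmult_1_r, !Cmult_0_r, cexp_0 in H.
replace (cexp w - 1 - w)%C with (cexp w + - w - (1 + 0))%C by ring.
replace (4 * _) with (2 * (2 * (Cmod w ^ 2 * exp (Cmod w)))) by ring; apply H.
- intros t; apply is_derive_Cplus; [apply is_derive_cexp | ].
  rewrite <- (Cmult_1_r (- w)) at 1; apply is_derive_Cscal.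
  apply is_derive_C; simpl; split; [exact (is_derive_id t) | exact (is_derive_const 0 t)].
- intros t Ht.
  replace (w * cexp (w * t) + - w)%C with (w * (cexp (w * t) - 1))%C by ring.
  rewrite Cmod_mult.
  apply Rle_trans with (Cmod w * (2 * (Cmod (w * t) * exp (Cmod w)))).
  2: { rewrite Cmod_mult, Cmod_R, Rabs_pos_eq by lra.
       assert (H' := Cmod_ge_0 w); assert (E := exp_pos (Cmod w)).
       assert (0 <= Cmod w ^ 2 * exp (Cmod w)) by nra.
       replace (Cmod w * (2 * (Cmod w * t * exp (Cmod w))))
         with (2 * (Cmod w ^ 2 * exp (Cmod w)) * t) by ring.
       nra. }
  apply Rmult_le_compat_l; [apply Cmod_ge_0 | ].
  apply (Rle_trans _ _ _ (cexp_lipschitz_0 _)).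
  apply Rmult_le_compat_l; [lra | ]; apply Rmult_le_compat_l; [apply Cmod_ge_0 | ].
  assert (L : Cmod (w * t) <= Cmod w).
  { rewrite Cmod_mult, Cmod_R, Rabs_pos_eq by lra; assert (H' := Cmod_ge_0 w); nra. }
  destruct L as [L | ->]; [left; now apply exp_increasing | right; reflexivity].
Qed.

(** * The secular equation *)

Lemma filterlim_C {T : Type} (F : (T -> Prop) -> Prop) {FF : Filter F} (f : T -> C) (z : C) :
  filterlim f F (locally z) <->
  filterlim (fun t => Re (f t)) F (locally (Re z)) /\
  filterlim (fun t => Im (f t)) F (locally (Im z)).
Proof.
split.
- intros H; destruct z as [p q]; split.
  + exact (filterlim_comp _ _ _ f fst F _ _ H (continuous_fst p q)).
  + exact (filterlim_comp _ _ _ f snd F _ _ H (continuous_snd p q)).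
- intros [H1 H2] P [eps HP].
  assert (K1 := H1 _ (locally_ball (Re z) eps)); assert (K2 := H2 _ (locally_ball (Im z) eps)).
  unfold filtermap in *; generalize (filter_and _ _ K1 K2); apply filter_imp.
  intros t [B1 B2]; apply HP; split; assumption.
Qed.

Lemma filterlim_Cplus {T : Type} (F : (T -> Prop) -> Prop) {FF : Filter F} (f g : T -> C) (y z : C) :
  filterlim f F (locally y) -> filterlim g F (locally z) ->
  filterlim (fun t => (f t + g t)%C) F (locally (y + z)%C).
Proof.
intros Hf Hg; exact (filterlim_comp_2 f g plus Hf Hg (filterlim_plus (V := C_R_NormedModule) y z)).
Qed.

Lemma filterlim_Cmult {T : Type} (F : (T -> Prop) -> Prop) {FF : Filter F} (f g : T -> C) (y z : C) :
  filterlim f F (locally y) -> filterlim g F (locally z) ->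
  filterlim (fun t => (f t * g t)%C) F (locally (y * z)%C).
Proof.
rewrite !filterlim_C by assumption; intros [F1 F2] [G1 G2].
assert (M : forall (p q : T -> R) (x x' : R), filterlim p F (locally x) -> filterlim q F (locally x') ->
  filterlim (fun t => p t * q t) F (locally (x * x'))).
{ intros p q x x' Hp Hq; exact (filterlim_comp_2 p q Rmult Hp Hq (filterlim_mult (K := R_AbsRing) x x')). }
split.
- apply (filterlim_comp_2 (fun t => Re (f t) * Re (g t)) (fun t => - (Im (f t) * Im (g t))) Rplus
    (G := locally (Re y * Re z)) (H := locally (- (Im y * Im z)))).
  + now apply M.
  + apply (filterlim_comp _ _ _ (fun t => Im (f t) * Im (g t)) Ropp _ (locally (Im y * Im z))).
    * now apply M.
    * apply (filterlim_opp (V := R_NormedModule)).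
  + apply (filterlim_plus (V := R_NormedModule)).
- apply (filterlim_comp_2 (fun t => Re (f t) * Im (g t)) (fun t => Im (f t) * Re (g t)) Rplus
    (G := locally (Re y * Im z)) (H := locally (Im y * Re z))); try now apply M.
  apply (filterlim_plus (V := R_NormedModule)).
Qed.

Lemma continuous_on_C_of_derive (D : R -> Prop) (u u' : R -> C) :
  (forall x, is_derive u x (u' x)) -> continuous_on D u.
Proof.
intros H x _; apply (filterlim_filter_le_1 (F := locally x)).
- intros P; unfold within; apply filter_imp; auto.
- apply (ex_derive_continuous (V := C_R_NormedModule) u x); eexists; apply H.
Qed.

(** The differential equation holds only inside the interval while the Robin conditions sit at its
    end points; one-sided continuity carries identities from one to the other. *)
Lemma eq_on_closed_interval (a : R) (f : R -> C) (c : C) :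
  0 < a -> continuous_on (fun x => - a <= x <= a) f ->
  (forall x, - a < x < a -> f x = c) -> forall x, - a <= x <= a -> f x = c.
Proof.
intros ha Hf Hc x Hx.
assert (PF : ProperFilter' (within (fun y => - a < y < a) (locally x))).
{ constructor; [ | apply within_filter, locally_filter].
  intros [eps H]; set (d := Rmin (eps / 2) (a / 2)).
  assert (Hd : 0 < d) by (unfold d; apply Rmin_pos; assert (E := cond_pos eps); lra).
  assert (H1 : d <= eps / 2) by apply Rmin_l; assert (H2 : d <= a / 2) by apply Rmin_r.
  assert (E := cond_pos eps).
  destruct (Rle_lt_dec x 0) as [L | L].
  - apply (H (x + d)); [ | lra]; change (Rabs (x + d - x) < eps).
    replace (x + d - x) with d by ring; rewrite Rabs_pos_eq; lra.
  - apply (H (x - d)); [ | lra]; change (Rabs (x - d - x) < eps).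
    replace (x - d - x) with (- d) by ring; rewrite Rabs_Ropp, Rabs_pos_eq; lra. }
apply (filterlim_locally_unique (V := C_R_NormedModule)
  (F := within (fun y => - a < y < a) (locally x)) f).
- apply (filterlim_filter_le_1 (F := within (fun y => - a <= y <= a) (locally x))).
  + intros P HP; unfold within in *; revert HP; apply filter_imp; intros y Hy Hy'; apply Hy; lra.
  + now apply Hf.
- apply (filterlim_within_ext (fun y => - a < y < a) (fun _ => c)).
  + intros y Hy; symmetry; now apply Hc.
  + apply filterlim_const.
Qed.

Lemma constant_of_zero_derive (a : R) (f : R -> C) :
  (forall x, - a < x < a -> is_derive f x (RtoC 0)) ->
  forall x y, - a < x < a -> - a < y < a -> f x = f y.
Proof.
intros H.
assert (K : forall x y, - a < x < a -> - a < y < a -> x < y -> f x = f y).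
{ intros x y Hx Hy Lxy; apply (eq_is_derive (V := C_R_NormedModule) f x y); [ | exact Lxy].
  intros t Ht; apply H; lra. }
intros x y Hx Hy; destruct (Rtotal_order x y) as [L | [-> | L]]; auto.
symmetry; auto.
Qed.

(** The operator [d ^ 2 - m ^ 2] factors as [(d + m) (d - m)], and [e^(m x)] is an integrating
    factor for [d + m]. Used with [m] and [- m], this replaces the general solution of the
    equation. *)
Lemma exponential_first_integral (a : R) (m : C) (u u' : R -> C) :
  0 < a ->
  continuous_on (fun x => - a <= x <= a) u -> continuous_on (fun x => - a <= x <= a) u' ->
  (forall x : R, - a < x < a -> is_derive u x (u' x)) ->
  (forall x : R, - a < x < a -> is_derive u' x (m * m * u x)%C) ->
  exists c : C, forall x, - a <= x <= a -> ((u' x - m * u x) * cexp (m * x) = c)%C.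
Proof.
intros ha Cu Cu' Du Du'.
set (p := fun x : R => ((u' x + (- m) * u x) * cexp (m * x))%C).
exists (p 0); intros x Hx; replace (_ * _)%C with (p x) by (unfold p; ring).
apply (eq_on_closed_interval a p (p 0)); trivial.
- intros y Hy; apply filterlim_Cmult; [apply within_filter, locally_filter | | ].
  + apply filterlim_Cplus; [apply within_filter, locally_filter | now apply Cu' | ].
    apply filterlim_Cmult; [apply within_filter, locally_filter | apply filterlim_const | now apply Cu].
  + apply (continuous_on_C_of_derive _ (fun x : R => cexp (m * x)) (fun x => m * cexp (m * x))%C);
      [apply is_derive_cexp | exact Hy].
- intros y Hy; apply (constant_of_zero_derive a p); [ | exact Hy | lra].
  intros t Ht.
  replace (RtoC 0) with ((m * m * u t + (- m) * u' t) * cexp (m * t)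
    + (u' t + (- m) * u t) * (m * cexp (m * t)))%C by ring.
  apply (is_derive_Cmult (fun t => (u' t + - m * u t)%C)).
  + apply is_derive_Cplus; [now apply Du' | ].
    apply is_derive_Cscal; now apply Du.
  + apply is_derive_cexp.
Qed.

(** The Robin condition at [a] for [e^(m x) + s e^(- m x)], divided by [e^(m a)]. By parity the
    condition at [- a] is then the same. *)
Definition secular (a : R) (s alpha m : C) : Prop :=
  (m + alpha = s * (m - alpha) * cexp (- (2 * a) * m))%C.

Definition unit_sign (s : C) : Prop := s = 1 \/ s = (- (1))%C.

Lemma cexp_2a (a : R) (m : C) : cexp (- (2 * a) * m) = (cexp (- (m * a)) * cexp (- (m * a)))%C.
Proof. rewrite <- cexp_plus; f_equal; ring. Qed.

Lemma robin_eigenvalue_of_secular (a : R) (s alpha m : C) :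
  0 < a -> 0 < Re m -> unit_sign s -> secular a s alpha m ->
  robin_eigenvalue a alpha (- (m * m)).
Proof.
intros ha hm Hs E.
assert (ss : (s * s = 1)%C) by (destruct Hs as [-> | ->]; ring).
set (u := fun x : R => (cexp (m * x) + s * cexp (- m * x))%C).
set (u' := fun x : R => (m * cexp (m * x) + s * (- m * cexp (- m * x)))%C).
set (u'' := fun x : R => (m * (m * cexp (m * x)) + s * (- m * (- m * cexp (- m * x))))%C).
assert (Du : forall x, is_derive u x (u' x)).
{ intros x; apply is_derive_Cplus; [ | apply is_derive_Cscal]; apply is_derive_cexp. }
assert (Du' : forall x, is_derive u' x (u'' x)).
{ intros x; apply is_derive_Cplus.
  - apply is_derive_Cscal, is_derive_cexp.
  - do 2 apply is_derive_Cscal; apply is_derive_cexp. }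
unfold secular in E; rewrite cexp_2a in E.
set (N := cexp (- (m * a))) in E.
assert (PN : (cexp (m * a) * N = 1)%C) by apply cexp_opp.
set (P := cexp (m * a)) in PN.
assert (Na : cexp (- m * a) = N) by (unfold N; f_equal; ring).
assert (Nma : cexp (m * (- a)%R) = N) by (unfold N; f_equal; rewrite RtoC_opp; ring).
assert (Pma : cexp (- m * (- a)%R) = P) by (unfold P; f_equal; rewrite RtoC_opp; ring).
assert (key : ((m + alpha) * P + s * (alpha - m) * N = 0)%C).
{ rewrite E.
  replace (_ + _)%C with (s * (m - alpha) * N * (P * N - 1))%C by ring.
  rewrite PN; ring. }
exists u, u'; split.
- now apply (continuous_on_C_of_derive _ u u').
- now apply (continuous_on_C_of_derive _ u' u'').
- intros x _; apply Du.
- intros x _; exists (u'' x); split; [apply Du' | unfold u'', u; ring].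
- unfold u, u'; rewrite Nma, Pma.
  replace (_ + _)%C with (s * ((m + alpha) * P + s * (alpha - m) * N)
    + (1 - s * s) * (alpha - m) * N)%C by ring.
  rewrite key, ss; ring.
- unfold u, u'; fold P; rewrite Na, <- key; ring.
(* The odd solution vanishes at 0, so another point is needed; at [a / 2] the two exponentials have
   different moduli because [Re m > 0]. *)
- exists (a / 2); split; [lra | ]; unfold u; intros H0.
  assert (H1 : cexp (m * (a / 2)%R) = (- s * cexp (- m * (a / 2)%R))%C).
  { transitivity ((cexp (m * (a / 2)%R) + s * cexp (- m * (a / 2)%R)) - s * cexp (- m * (a / 2)%R))%C;
      [ring | rewrite H0; ring]. }
  apply (f_equal Cmod) in H1; rewrite Cmod_mult, !Cmod_cexp in H1.
  replace (Cmod (- s)) with 1 in H1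
    by (destruct Hs as [-> | ->]; rewrite !Cmod_opp, Cmod_1; reflexivity).
  rewrite Rmult_1_l, !re_scal_r in H1; apply exp_inv in H1.
  destruct m as [p q]; unfold Re in *; simpl in *; nra.
Qed.

Lemma secular_of_robin_eigenvalue (a : R) (alpha m : C) :
  0 < a -> 0 < Re m -> robin_eigenvalue a alpha (- (m * m)) ->
  exists s : C, unit_sign s /\ secular a s alpha m.
Proof.
intros ha hm [u [u' [Cu Cu' Du Eq L0 R0 [x0 [Hx0 nz]]]]].
assert (m0 : m <> 0) by (intros ->; simpl in hm; lra).
assert (Du' : forall x, - a < x < a -> is_derive u' x (m * m * u x)%C).
{ intros x Hx; destruct (Eq x Hx) as [v [Hv Ev]].
  replace (m * m * u x)%C with v; [exact Hv | ].
  transitivity (- - v)%C; [ring | rewrite Ev; ring]. }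
destruct (exponential_first_integral a m u u') as [P HP]; trivial.
destruct (exponential_first_integral a (- m) u u') as [Q HQ]; trivial.
{ intros x Hx; replace (- m * - m * u x)%C with (m * m * u x)%C by ring; auto. }
assert (PL := HP (- a) ltac:(lra)); assert (PR := HP a ltac:(lra)).
assert (QL := HQ (- a) ltac:(lra)); assert (QR := HQ a ltac:(lra)).
set (N := cexp (- (m * a))).
assert (MN : (cexp (m * a) * N = 1)%C) by apply cexp_opp.
set (M := cexp (m * a)) in *.
replace (cexp (- m * a)) with N in QR by (unfold N; f_equal; ring).
replace (cexp (m * (- a)%R)) with N in PL by (unfold N; f_equal; rewrite RtoC_opp; ring).
replace (cexp (- m * (- a)%R)) with M in QL by (unfold M; f_equal; rewrite RtoC_opp; ring).
set (U := u a) in *; set (V := u (- a)) in *.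
assert (EL : u' (- a) = (alpha * V)%C).
{ transitivity ((alpha * V) - (- u' (- a)%R + alpha * V))%C; [ring | rewrite L0; ring]. }
assert (ER : u' a = (- (alpha * U))%C).
{ transitivity ((u' a + alpha * U) - alpha * U)%C; [ring | rewrite R0; ring]. }
rewrite EL in PL, QL; rewrite ER in PR, QR.
(* Eliminating the two constants gives a system symmetric under the exchange of [U] and [V]. Its sum
   and its difference are the secular equations for [s = 1] and [s = -1], multiplied by [U + V] and
   [U - V]. *)
assert (E1 : ((m + alpha) * U = (m - alpha) * (N * N) * V)%C).
{ transitivity ((- - ((m + alpha) * U)) * (M * N))%C; [rewrite MN; ring | ].
  transitivity (- ((- (alpha * U) - m * U) * M) * N)%C; [ring | rewrite PR, <- PL; ring]. }
assert (E2 : ((m + alpha) * V = (m - alpha) * (N * N) * U)%C).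
{ transitivity (((m + alpha) * V) * (M * N))%C; [rewrite MN; ring | ].
  transitivity (((alpha * V - - m * V) * M) * N)%C; [ring | rewrite QL, <- QR; ring]. }
unfold secular; rewrite cexp_2a; fold N.
assert (cancel : forall x y z : C, z <> 0 -> (x * z = y * z)%C -> x = y).
{ intros x y z Hz H; transitivity (x * z / z)%C; [field; exact Hz | rewrite H; field; exact Hz]. }
destruct (Ceq_dec (U + V) 0) as [S0 | S0].
2: { exists 1; split; [now left | ]; apply (cancel _ _ _ S0).
     transitivity ((m + alpha) * U + (m + alpha) * V)%C; [ring | rewrite E1, E2; ring]. }
destruct (Ceq_dec (U - V) 0) as [D0 | D0].
2: { exists (- (1))%C; split; [now right | ]; apply (cancel _ _ _ D0).
     transitivity ((m + alpha) * U - (m + alpha) * V)%C; [ring | rewrite E1, E2; ring]. }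
(* If both factors vanish, [u] and [u'] vanish at [a], hence so do both constants; then [u' = m u]
   and [u' = - m u] at [x0], which forces [u x0 = 0]. *)
exfalso; apply nz.
assert (two : RtoC 2 <> 0) by (intros H; apply RtoC_inj in H; lra).
assert (U0 : U = 0).
{ apply (cancel _ _ _ two); transitivity ((U + V) + (U - V))%C; [ring | rewrite S0, D0; ring]. }
rewrite U0 in PR, QR.
assert (P0 : P = 0) by (rewrite <- PR; ring).
assert (Q0 : Q = 0) by (rewrite <- QR; ring).
assert (Px := HP x0 ltac:(lra)); assert (Qx := HQ x0 ltac:(lra)).
rewrite P0 in Px; rewrite Q0 in Qx.
assert (A1 : (u' x0 - m * u x0 = 0)%C).
{ apply (cancel _ _ _ (cexp_neq_0 (m * x0))); rewrite Px; ring. }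
assert (A2 : (u' x0 - - m * u x0 = 0)%C).
{ apply (cancel _ _ _ (cexp_neq_0 (- m * x0))); rewrite Qx; ring. }
apply (cancel _ _ _ m0), (cancel _ _ _ two).
transitivity ((u' x0 - - m * u x0) - (u' x0 - m * u x0))%C; [ring | rewrite A1, A2; ring].
Qed.

(** * Sectors *)

(** The form without powers that the nonlinear arithmetic below works with. *)
Lemma Cmod_sqr (z : C) : Cmod z * Cmod z = Re z * Re z + Im z * Im z.
Proof. assert (H := Cmod2_alt z); simpl in H; unfold Re, Im in *; lra. Qed.

Lemma cos_Rabs (t : R) : cos (Rabs t) = cos t.
Proof. unfold Rabs; destruct (Rcase_abs t); [apply cos_neg | reflexivity]. Qed.

(** Since [cos] decreases on [[0, PI]], [|arg z| < theta] compares cosines. This trades the argument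
    for an inequality between [Re z] and [Cmod z]. *)
Lemma sector_plus_iff (theta : R) (z : C) :
  0 < theta <= PI -> (sector_plus theta z <-> z <> 0 /\ Cmod z * cos theta < Re z).
Proof.
intros Ht; split.
- intros [t [[nz [tI Ez]] Lt]]; split; [exact nz | ].
  apply Cmod_gt_0 in nz.
  assert (Rz : Re z = Cmod z * cos t) by (rewrite Ez at 1; reflexivity).
  rewrite Rz; apply Rmult_lt_compat_l; [exact nz | ].
  rewrite <- (cos_Rabs t); apply cos_decreasing_1; try lra; apply Rabs_pos.
- intros [nz L]; assert (pz := proj1 (Cmod_gt_0 z) nz).
  assert (B := Re_bounds z).
  set (x := Re z / Cmod z).
  assert (Rx : Re z = Cmod z * x) by (unfold x; field; lra).
  assert (Bx : -1 <= x <= 1).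
  { split; apply (Rmult_le_reg_l (Cmod z)); lra. }
  assert (Lx : cos theta < x) by (apply (Rmult_lt_reg_l (Cmod z)); lra).
  assert (At := acos_bound x); assert (Ct := cos_acos x Bx).
  assert (Lt : acos x < theta).
  { apply cos_decreasing_0; lra. }
  assert (St : sin (acos x) = sqrt (1 - x ^ 2)) by (rewrite sin_acos by exact Bx; f_equal; unfold Rsqr; ring).
  assert (Q := Cmod_sqr z).
  assert (Ix : Rabs (Im z) = Cmod z * sqrt (1 - x ^ 2)).
  { apply Rsqr_inj; [apply Rabs_pos | apply Rmult_le_pos; [lra | apply sqrt_pos] | ].
    rewrite <- Rsqr_abs, Rsqr_mult, Rsqr_sqrt by nra; unfold Rsqr; nra. }
  destruct (Rle_lt_dec 0 (Im z)) as [I | I].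
  + exists (acos x); split; [ | rewrite Rabs_pos_eq; lra].
    split; [exact nz | split; [lra | ]].
    rewrite Ct, St, <- Rx, <- Ix, Rabs_pos_eq by exact I; apply surjective_pairing.
  + exists (- acos x); split; [ | rewrite Rabs_Ropp, Rabs_pos_eq; lra].
    split; [exact nz | split; [lra | ]].
    rewrite cos_neg, sin_neg, Ct, St, <- Rx.
    replace (Cmod z * - sqrt (1 - x ^ 2)) with (- Rabs (Im z)) by (rewrite Ix; ring).
    rewrite Rabs_left, Ropp_involutive by exact I; apply surjective_pairing.
Qed.

Lemma sector_minus_iff (phi : R) (z : C) :
  0 < phi <= PI -> (sector_minus phi z <-> z <> 0 /\ Cmod z * cos phi < Re (- z)).
Proof.
intros H; unfold sector_minus; rewrite sector_plus_iff, Cmod_opp by exact H.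
split; intros [nz L]; (split; [ | exact L]); intros E; apply nz.
- rewrite E; ring.
- transitivity (- - z)%C; [ring | rewrite E; ring].
Qed.

Lemma sector_plus_mono (theta theta' : R) (z : C) :
  theta <= theta' -> sector_plus theta z -> sector_plus theta' z.
Proof. intros L [t [H Ht]]; exists t; split; [exact H | lra]. Qed.

(* [sin (theta / 2)] *)
Definition half_sin (theta : R) : R := sqrt ((1 - cos theta) / 2).

Lemma half_sin_bounds (theta : R) :
  0 < theta <= PI -> 0 < half_sin theta /\ half_sin theta ^ 2 = (1 - cos theta) / 2.
Proof.
intros H; assert (L : cos theta < 1).
{ rewrite <- cos_0; apply cos_decreasing_1; lra. }
split; [apply sqrt_lt_R0; lra | apply pow2_sqrt; lra].
Qed.

(** Squared, the claim reads [- cos theta < cos (2 phi)], that is [2 phi < PI - theta]: this is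
    where the restriction on [theta] enters. *)
Lemma half_sin_lt_cos (phi theta : R) :
  0 < phi < PI / 2 -> 0 < theta < PI - 2 * phi -> half_sin theta < cos phi.
Proof.
intros Hp Ht.
assert (C0 : 0 < cos phi) by (apply cos_gt_0; lra).
assert (L : cos (PI - theta) < cos (2 * phi)) by (apply cos_decreasing_1; lra).
rewrite Rtrigo_facts.cos_pi_minus, cos_2a_cos in L.
rewrite <- (sqrt_pow2 (cos phi)) by lra; unfold half_sin; apply sqrt_lt_1_alt.
assert (B := COS_bound theta); split; [lra | simpl; lra].
Qed.

(** Here [- lambda] has argument at most [PI - theta] in absolute value, so its principal root has
    argument at most [(PI - theta) / 2], whose cosine is [sin (theta / 2)]. *)
Lemma root_outside_sector (theta : R) (lambda : C) :
  0 < theta <= PI -> lambda <> 0 -> ~ sector_plus theta lambda ->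
  exists m : C, lambda = (- (m * m))%C /\ 0 < Re m /\ half_sin theta * Cmod m <= Re m.
Proof.
intros Ht nz ns; assert (pz := proj1 (Cmod_gt_0 lambda) nz).
destruct (half_sin_bounds theta Ht) as [kp k2].
assert (L : Re lambda <= Cmod lambda * cos theta).
{ apply Rnot_lt_le; intros L; apply ns, sector_plus_iff; auto. }
set (r := Cmod lambda) in *.
(* [p + i q] is the principal square root of [- lambda]; staying off [T_theta^+] is what makes [p]
   positive. *)
set (p := sqrt ((r - Re lambda) / 2)).
assert (B : 0 < (r - Re lambda) / 2).
{ assert (0 < (1 - cos theta) / 2) by (rewrite <- k2; nra); nra. }
assert (pp : 0 < p) by (apply sqrt_lt_R0; lra).
assert (p2 : p * p = (r - Re lambda) / 2) by (apply sqrt_def; lra).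
assert (Q := Cmod_sqr lambda); fold r in Q.
set (q := - Im lambda / (2 * p)).
assert (pq : p * q = - Im lambda / 2) by (unfold q; field; lra).
assert (q2 : q * q = (r + Re lambda) / 2).
{ apply (Rmult_eq_reg_l (p * p)); [ | nra].
  transitivity ((p * q) * (p * q)); [ring | rewrite pq, p2; nra]. }
assert (E : lambda = (- ((p, q) * (p, q)))%C).
{ apply injective_projections; simpl; unfold Re, Im in *; lra. }
exists (p, q); split; [exact E | split; [exact pp | ]].
apply Rsqr_incr_0; [ | | simpl; lra].
- unfold Rsqr; replace (half_sin theta * Cmod (p, q) * (half_sin theta * Cmod (p, q)))
    with (half_sin theta ^ 2 * (Cmod (p, q) * Cmod (p, q))) by ring.
  rewrite k2, <- Cmod_mult, <- Cmod_opp, <- E; fold r; simpl; nra.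
- apply Rmult_le_pos; [lra | apply Cmod_ge_0].
Qed.

Lemma square_outside_sector (theta : R) (m : C) :
  0 < theta <= PI -> half_sin theta * Cmod m <= Re m -> ~ sector_plus theta (- (m * m)).
Proof.
intros Ht H S; apply sector_plus_iff in S; [ | exact Ht]; destruct S as [_ S].
destruct (half_sin_bounds theta Ht) as [kp k2].
rewrite Cmod_opp, Cmod_mult in S.
assert (Q := Cmod_sqr m); assert (P := Cmod_ge_0 m).
assert (R2 : half_sin theta ^ 2 * (Cmod m * Cmod m) <= Re m * Re m).
{ assert (0 <= half_sin theta * Cmod m) by nra.
  replace (_ * _) with ((half_sin theta * Cmod m) * (half_sin theta * Cmod m)) by ring.
  now apply Rmult_le_compat. }
rewrite k2 in R2.
replace (Re (- (m * m))) with (Im m * Im m - Re m * Re m) in S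
  by (unfold Re, Im; simpl; ring).
nra.
Qed.

(** * The branches of the secular equation *)

Lemma linear_exp_decay (K c : R) : 0 <= K -> 0 < c ->
  exists M : R, forall x : R, M < x -> K * (1 + x) * exp (- (c * x)) <= 1 / 4.
Proof.
(* For [x > 1], [1 + x <= 2 x], and [e^(c x) >= (1 + c x / 2) ^ 2 >= (c x) ^ 2 / 4]; so
   [32 K <= c ^ 2 x] suffices. *)
intros HK Hc; exists (Rmax 1 (32 * K / c ^ 2)); intros x Hx.
assert (x1 : 1 < x) by exact (Rle_lt_trans _ _ _ (Rmax_l _ _) Hx).
assert (x2 : 32 * K / c ^ 2 < x) by exact (Rle_lt_trans _ _ _ (Rmax_r _ _) Hx).
assert (c2 : 0 < c ^ 2) by nra.
assert (x3 : 32 * K < x * c ^ 2).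
{ apply (Rmult_lt_compat_r (c ^ 2)) in x2; [ | exact c2].
  replace (32 * K / c ^ 2 * c ^ 2) with (32 * K) in x2 by (field; lra); exact x2. }
assert (E : (1 + c * x / 2) * (1 + c * x / 2) <= exp (c * x)).
{ replace (c * x) with (c * x / 2 + c * x / 2) at 3 by field; rewrite exp_plus.
  assert (H := exp_ineq1_le (c * x / 2)); assert (0 < c * x) by nra.
  apply Rmult_le_compat; lra. }
rewrite exp_Ropp; assert (Ep := exp_pos (c * x)).
apply (Rmult_le_reg_r (exp (c * x))); [exact Ep | ].
rewrite Rmult_assoc, Rinv_l, Rmult_1_r by lra.
assert (K * (1 + x) <= 2 * (K * x)) by nra.
assert (0 < c * x) by nra.
assert (32 * K * x <= x * c ^ 2 * x) by nra.
nra.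
Qed.

Lemma secular_iff (a : R) (s alpha m : C) :
  secular a s alpha m <-> m = (- alpha + s * (m - alpha) * cexp (- (2 * a) * m))%C.
Proof.
unfold secular; split; intros H.
- rewrite <- H; ring.
- rewrite H at 1; ring.
Qed.

Lemma Cmod_unit_sign (s : C) : unit_sign s -> Cmod s = 1.
Proof. intros [-> | ->]; [ | rewrite Cmod_opp]; apply Cmod_1. Qed.

Lemma Cmod_decay (a : R) (m : C) : Cmod (cexp (- (2 * a) * m)) = exp (- (2 * a * Re m)).
Proof.
rewrite Cmod_cexp; f_equal; rewrite <- RtoC_mult, <- RtoC_opp, re_scal_l; ring.
Qed.

(* Since [m - alpha = 2 m - (m + alpha)], the secular equation bounds [m + alpha]
   by [m] alone, whatever the size of [alpha]. *)
Lemma secular_root_near (a k : R) : 0 < a -> 0 < k ->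
  exists M : R, forall s alpha m : C, unit_sign s -> k * Cmod m <= Re m -> M < Cmod m ->
    secular a s alpha m -> Cmod (m + alpha) <= 1.
Proof.
intros ha hk; destruct (linear_exp_decay 1 (2 * a * k)) as [M HM]; [lra | nra | ].
exists M; intros s alpha m Hs Hm LM E; specialize (HM _ LM).
assert (mp := Cmod_ge_0 m).
assert (D : Cmod (cexp (- (2 * a) * m)) <= exp (- (2 * a * k * Cmod m))).
{ rewrite Cmod_decay; apply exp_le_compat.
  assert (2 * a * (k * Cmod m) <= 2 * a * Re m) by nra; lra. }
set (e := exp _) in *; assert (ep : 0 < e) by apply exp_pos.
assert (T : Cmod (m - alpha) <= 2 * Cmod m + Cmod (m + alpha)).
{ replace (m - alpha)%C with (2 * m + - (m + alpha))%C by ring.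
  apply (Rle_trans _ _ _ (Cmod_triangle _ _)).
  rewrite Cmod_opp, Cmod_mult, Cmod_R, Rabs_pos_eq by lra; lra. }
assert (E' := f_equal Cmod E); rewrite !Cmod_mult, (Cmod_unit_sign s Hs), Rmult_1_l in E'.
assert (U : Cmod (m + alpha) <= (2 * Cmod m + Cmod (m + alpha)) * e).
{ rewrite E' at 1; apply Rmult_le_compat; try apply Cmod_ge_0; assumption. }
(* From [(1 + |m|) e <= 1 / 4] follow [e <= 1 / 4] and [2 |m| e <= 1 / 2], so the unknown on the
   right of [U] is absorbed on the left, leaving at most [2 / 3]. *)
assert (p := Cmod_ge_0 (m + alpha)); nra.
Qed.

(** Banach's theorem on the closed unit disk around [c]. The first Picard step has length at most 1,
    so the steps are dominated by a geometric series; convergence is taken coordinatewise. *)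
Lemma contraction_fixed_point (f : C -> C) (c : C) :
  (forall z, Cmod (z - c) <= 1 -> Cmod (f z - c) <= 1) ->
  (forall z w, Cmod (z - c) <= 1 -> Cmod (w - c) <= 1 ->
     Cmod (f z - f w) <= 1 / 4 * Cmod (z - w)) ->
  exists z, Cmod (z - c) <= 1 /\ f z = z.
Proof.
intros Hd Hc.
set (x := fix x n := match n with O => c | S n => f (x n) end).
assert (Xd : forall n, Cmod (x n - c) <= 1).
{ induction n as [ | n IH]; simpl; [ | now apply Hd].
  replace (c - c)%C with (RtoC 0) by ring; rewrite Cmod_0; lra. }
assert (Xs : forall n, Cmod (x (S n) - x n) <= (1 / 4) ^ n).
{ induction n as [ | n IH]; [exact (Xd 1%nat) | ].
  apply (Rle_trans _ (1 / 4 * Cmod (x (S n) - x n))); [apply Hc; apply Xd | ].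
  simpl pow; apply Rmult_le_compat_l; [lra | exact IH]. }
assert (cv : forall u : nat -> R, (forall n, Rabs (u (S n) - u n) <= (1 / 4) ^ n) ->
  exists l : R, is_lim_seq u l).
{ intros u Hu.
  assert (G : ex_series (fun n => u (S n) - u n)).
  { apply (ex_series_le (K := R_AbsRing) (V := R_CompleteNormedModule) _ (fun n => (1 / 4) ^ n));
      [exact Hu | ].
    apply ex_series_geom; rewrite Rabs_pos_eq; lra. }
  destruct G as [l Hl]; exists (l + u O).
  apply is_lim_seq_incr_1.
  apply (is_lim_seq_ext (fun n => sum_n (fun n => u (S n) - u n) n + u O)).
  - induction n as [ | n IH]; [rewrite sum_O; ring | ].
    rewrite sum_Sn; unfold plus; simpl; lra.
  - apply (is_lim_seq_plus' _ (fun _ => u O) l (u O)); [exact Hl | apply is_lim_seq_const]. }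
destruct (cv (fun n => Re (x n))) as [l1 H1].
{ intros n; exact (Rle_trans _ _ _ (re_le_Cmod (x (S n) - x n)) (Xs n)). }
destruct (cv (fun n => Im (x n))) as [l2 H2].
{ intros n; exact (Rle_trans _ _ _ (im_le_Cmod (x (S n) - x n)) (Xs n)). }
set (z := (l1, l2) : C).
assert (Z : forall eps, 0 < eps -> exists n, Cmod (x n - z) < eps /\ Cmod (x (S n) - z) < eps).
{ intros eps Heps.
  assert (e2 : 0 < eps / 2) by lra.
  destruct (proj2 (is_lim_seq_spec _ _) H1 (mkposreal _ e2)) as [N1 K1].
  destruct (proj2 (is_lim_seq_spec _ _) H2 (mkposreal _ e2)) as [N2 K2].
  assert (K : forall n, (N1 + N2 <= n)%nat -> Cmod (x n - z) < eps).
  { intros n Hn; apply (Rle_lt_trans _ _ _ (Cmod_le_components _)).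
    specialize (K1 n ltac:(lia)); specialize (K2 n ltac:(lia)).
    simpl in K1, K2; unfold Re, Im in *; simpl; unfold Rminus in *; lra. }
  exists (N1 + N2)%nat; split; apply K; lia. }
assert (Zd : Cmod (z - c) <= 1).
{ apply Rle_plus_epsilon; intros eps Heps; destruct (Z eps Heps) as [n [Hn _]].
  replace (z - c)%C with ((x n - c) + - (x n - z))%C by ring.
  apply (Rle_trans _ _ _ (Cmod_triangle _ _)); rewrite Cmod_opp.
  specialize (Xd n); lra. }
exists z; split; [exact Zd | ].
assert (F : Cmod (f z - z) <= 0).
{ apply Rle_plus_epsilon; intros eps Heps; destruct (Z (eps / 2)) as [n [Hn Hn']]; [lra | ].
  replace (f z - z)%C with ((f z - f (x n)) + (x (S n) - z))%C by (simpl; ring).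
  apply (Rle_trans _ _ _ (Cmod_triangle _ _)).
  assert (K := Hc z (x n) Zd (Xd n)); rewrite (Cmod_minus_sym z) in K; lra. }
transitivity ((f z - z) + z)%C; [ring | ].
rewrite (Cmod_eq_0 (f z - z)); [ring | ].
assert (P := Cmod_ge_0 (f z - z)); lra.
Qed.

(* Bounds [e^(-2 a m)] on the unit disk around [- alpha]. *)
Definition tail (a : R) (alpha : C) : R := exp (2 * a * (Re alpha + 1)).

(* Lipschitz constant of [w |-> e^(-2 a w)] at [0] on the disk of radius 3. *)
Definition lip (a : R) : R := 4 * a * exp (6 * a).

(** One inequality that yields all the smallness needed. On the disk [|m - alpha| <= 2 |alpha| + 1]
    and the exponential is at most [tail]; the product of these bounds makes the secular map
    preserve the disk, and with the factor [lip] it makes it a contraction. *)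
Definition far (a : R) (alpha : C) : Prop :=
  tail a alpha * (1 + (2 * Cmod alpha + 1) * (1 + lip a)) <= 1 / 4.

Lemma lip_ge (a : R) : 0 < a -> 4 * a <= lip a.
Proof.
intros ha; unfold lip; assert (H := exp_ineq1_le (6 * a)); nra.
Qed.

Lemma far_bounds (a : R) (alpha : C) : 0 < a -> far a alpha ->
  0 < tail a alpha <= 1 / 4 /\ (2 * Cmod alpha + 1) * tail a alpha <= 1 / 4 /\
  tail a alpha + (2 * Cmod alpha + 1) * tail a alpha * lip a <= 1 / 4.
Proof.
unfold far; intros ha H; assert (L := lip_ge a ha); assert (p := Cmod_ge_0 alpha).
assert (t : 0 < tail a alpha) by apply exp_pos.
set (t' := tail a alpha) in *; set (y := 2 * Cmod alpha + 1) in *.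
assert (0 < y) by (unfold y; lra).
assert (0 < y * t') by nra.
assert (0 < y * t' * lip a) by (apply Rmult_lt_0_compat; lra).
repeat split; lra.
Qed.

Lemma far_in_sector (a k : R) : 0 < a -> 0 < k ->
  exists M : R, forall alpha : C, k * Cmod alpha <= Re (- alpha) -> M < Cmod alpha -> far a alpha.
Proof.
intros ha hk; assert (L := lip_ge a ha).
assert (ea := exp_pos (2 * a)).
destruct (linear_exp_decay (exp (2 * a) * (1 + 2 * (1 + lip a))) (2 * a * k)) as [M HM]; [nra | nra | ].
exists M; intros alpha Ha LM; specialize (HM _ LM); unfold far.
apply (Rle_trans _ _ _) with (2 := HM).
assert (p := Cmod_ge_0 alpha).
assert (T : tail a alpha <= exp (2 * a) * exp (- (2 * a * k * Cmod alpha))).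
{ unfold tail; rewrite <- exp_plus; apply exp_le_compat.
  unfold Re, Copp in *; simpl in *.
  assert (2 * a * (k * Cmod alpha) <= 2 * a * - fst alpha) by (apply Rmult_le_compat_l; lra).
  lra. }
set (e := exp (- _)) in *; assert (0 < e) by apply exp_pos.
apply Rle_trans with (exp (2 * a) * e * (1 + (2 * Cmod alpha + 1) * (1 + lip a))).
- apply Rmult_le_compat_r; [nra | exact T].
- replace (exp (2 * a) * (1 + 2 * (1 + lip a)) * (1 + Cmod alpha) * e)
    with (exp (2 * a) * e * ((1 + 2 * (1 + lip a)) * (1 + Cmod alpha))) by ring.
  apply Rmult_le_compat_l; nra.
Qed.

(** * Estimates on the unit disk around [- alpha] *)

Lemma decay_in_disk (a : R) (alpha m : C) : 0 < a -> Cmod (m + alpha) <= 1 ->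
  Cmod (cexp (- (2 * a) * m)) <= tail a alpha.
Proof.
intros ha H; rewrite Cmod_decay; apply exp_le_compat.
assert (B := Re_bounds (m + alpha)); unfold Re, Cplus in *; simpl in *; nra.
Qed.

Lemma Cmod_minus_disk (alpha m : C) : Cmod (m + alpha) <= 1 -> Cmod (m - alpha) <= 2 * Cmod alpha + 1.
Proof.
intros H; replace (m - alpha)%C with ((m + alpha) + - (2 * alpha))%C by ring.
apply (Rle_trans _ _ _ (Cmod_triangle _ _)).
rewrite Cmod_opp, Cmod_mult, Cmod_R, Rabs_pos_eq by lra; lra.
Qed.

Lemma Cmod_2a (a : R) (w : C) : 0 < a -> Cmod (- (2 * a) * w) = 2 * a * Cmod w.
Proof.
intros ha; rewrite Cmod_mult, Cmod_opp, <- RtoC_mult, Cmod_R, Rabs_pos_eq; lra.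
Qed.

(** Factoring out [e^(-2 a n)] reduces the estimate to one at 0 and keeps the exponentially small
    factor in the Lipschitz constant. *)
Lemma decay_lipschitz (a : R) (m n : C) : 0 < a -> Cmod (m - n) <= 3 ->
  Cmod (cexp (- (2 * a) * m) - cexp (- (2 * a) * n)) <=
  Cmod (cexp (- (2 * a) * n)) * lip a * Cmod (m - n).
Proof.
intros ha H.
replace (cexp (- (2 * a) * m) - cexp (- (2 * a) * n))%C
  with (cexp (- (2 * a) * n) * (cexp (- (2 * a) * (m - n)) - 1))%C.
2: { transitivity (cexp (- (2 * a) * n) * cexp (- (2 * a) * (m - n)) - cexp (- (2 * a) * n))%C; [ring | ].
     rewrite <- cexp_plus; do 2 f_equal; ring. }
rewrite Cmod_mult, Rmult_assoc; apply Rmult_le_compat_l; [apply Cmod_ge_0 | ].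
apply (Rle_trans _ _ _ (cexp_lipschitz_0 _)); rewrite Cmod_2a by exact ha; unfold lip.
assert (p := Cmod_ge_0 (m - n)).
assert (E : exp (2 * a * Cmod (m - n)) <= exp (6 * a)) by (apply exp_le_compat; nra).
assert (0 <= 4 * a * Cmod (m - n)) by nra.
nra.
Qed.

Lemma decay_taylor (a : R) (m n : C) : 0 < a -> Cmod (m - n) <= 3 ->
  Cmod (cexp (- (2 * a) * m) - cexp (- (2 * a) * n) + 2 * a * cexp (- (2 * a) * n) * (m - n)) <=
  Cmod (cexp (- (2 * a) * n)) * (16 * a ^ 2 * exp (6 * a)) * Cmod (m - n) ^ 2.
Proof.
intros ha H.
replace (_ + _)%C
  with (cexp (- (2 * a) * n) * (cexp (- (2 * a) * (m - n)) - 1 - - (2 * a) * (m - n)))%C.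
2: { replace (cexp (- (2 * a) * m)) with (cexp (- (2 * a) * n) * cexp (- (2 * a) * (m - n)))%C; [ring | ].
     rewrite <- cexp_plus; f_equal; ring. }
rewrite Cmod_mult, Rmult_assoc; apply Rmult_le_compat_l; [apply Cmod_ge_0 | ].
apply (Rle_trans _ _ _ (cexp_taylor_1 _)); rewrite Cmod_2a by exact ha.
assert (p := Cmod_ge_0 (m - n)).
assert (E : exp (2 * a * Cmod (m - n)) <= exp (6 * a)) by (apply exp_le_compat; nra).
assert (0 <= 16 * a ^ 2 * Cmod (m - n) ^ 2) by nra.
replace (4 * _) with (16 * a ^ 2 * Cmod (m - n) ^ 2 * exp (2 * a * Cmod (m - n))) by ring.
replace (16 * a ^ 2 * exp (6 * a) * Cmod (m - n) ^ 2)
  with (16 * a ^ 2 * Cmod (m - n) ^ 2 * exp (6 * a)) by ring.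
now apply Rmult_le_compat_l.
Qed.

Definition secular_map (a : R) (s alpha m : C) : C :=
  (- alpha + s * (m - alpha) * cexp (- (2 * a) * m))%C.

Lemma secular_map_disk (a : R) (s alpha m : C) : 0 < a -> unit_sign s -> far a alpha ->
  Cmod (m + alpha) <= 1 -> Cmod (secular_map a s alpha m + alpha) <= 1 / 4.
Proof.
intros ha Hs Hf Hm; destruct (far_bounds a alpha ha Hf) as [_ [B _]].
unfold secular_map; replace (_ + _)%C with (s * (m - alpha) * cexp (- (2 * a) * m))%C by ring.
rewrite !Cmod_mult, (Cmod_unit_sign s Hs), Rmult_1_l.
apply (Rle_trans _ _ _) with (2 := B).
apply Rmult_le_compat; try apply Cmod_ge_0; [now apply Cmod_minus_disk | now apply decay_in_disk].
Qed.

Lemma secular_map_contraction (a : R) (s alpha m n : C) : 0 < a -> unit_sign s -> far a alpha ->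
  Cmod (m + alpha) <= 1 -> Cmod (n + alpha) <= 1 ->
  Cmod (secular_map a s alpha m - secular_map a s alpha n) <= 1 / 4 * Cmod (m - n).
Proof.
intros ha Hs Hf Hm Hn; destruct (far_bounds a alpha ha Hf) as [[t0 _] [_ B]].
assert (L := lip_ge a ha).
unfold secular_map; set (E := fun m => cexp (- (2 * a) * m)).
change (Cmod (- alpha + s * (m - alpha) * E m - (- alpha + s * (n - alpha) * E n)) <= 1 / 4 * Cmod (m - n)).
(* Product rule for differences; its two terms match the two summands of the last bound in
   [far_bounds]. *)
replace (- alpha + s * (m - alpha) * E m - (- alpha + s * (n - alpha) * E n))%C
  with (s * ((m - n) * E m + (n - alpha) * (E m - E n)))%C by ring.
rewrite Cmod_mult, (Cmod_unit_sign s Hs), Rmult_1_l.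
apply (Rle_trans _ _ _ (Cmod_triangle _ _)); rewrite !Cmod_mult.
assert (D3 : Cmod (m - n) <= 3).
{ replace (m - n)%C with ((m + alpha) + - (n + alpha))%C by ring.
  apply (Rle_trans _ _ _ (Cmod_triangle _ _)); rewrite Cmod_opp; lra. }
assert (p := Cmod_ge_0 (m - n)).
assert (Em : Cmod (E m) <= tail a alpha) by now apply decay_in_disk.
assert (En : Cmod (E n) <= tail a alpha) by now apply decay_in_disk.
assert (Na := Cmod_minus_disk alpha n Hn).
assert (Ed : Cmod (E m - E n) <= tail a alpha * lip a * Cmod (m - n)).
{ apply (Rle_trans _ _ _ (decay_lipschitz a m n ha D3)).
  apply Rmult_le_compat_r; [exact p | ]; apply Rmult_le_compat_r; [lra | exact En]. }
apply Rle_trans with (Cmod (m - n) * tail a alpha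
  + (2 * Cmod alpha + 1) * (tail a alpha * lip a * Cmod (m - n))).
- apply Rplus_le_compat.
  + now apply Rmult_le_compat_l.
  + apply Rmult_le_compat; try apply Cmod_ge_0; assumption.
- replace (_ + _) with
    ((tail a alpha + (2 * Cmod alpha + 1) * tail a alpha * lip a) * Cmod (m - n)) by ring.
  now apply Rmult_le_compat_r.
Qed.

Lemma secular_root_exists (a : R) (s alpha : C) : 0 < a -> unit_sign s -> far a alpha ->
  exists m : C, Cmod (m + alpha) <= 1 /\ secular a s alpha m.
Proof.
intros ha Hs Hf.
assert (K : forall z, (z - - alpha = z + alpha)%C) by (intros z; ring).
destruct (contraction_fixed_point (secular_map a s alpha) (- alpha)) as [m [Hm E]].
- intros z; rewrite !K; intros Hz.
  assert (H := secular_map_disk a s alpha z ha Hs Hf Hz); lra.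
- intros z w; rewrite !K; intros Hz Hw; now apply secular_map_contraction.
- exists m; rewrite K in Hm; split; [exact Hm | ].
  apply secular_iff; symmetry; exact E.
Qed.

Lemma secular_root_unique (a : R) (s alpha m n : C) : 0 < a -> unit_sign s -> far a alpha ->
  Cmod (m + alpha) <= 1 -> Cmod (n + alpha) <= 1 ->
  secular a s alpha m -> secular a s alpha n -> m = n.
Proof.
intros ha Hs Hf Hm Hn Em En.
assert (H := secular_map_contraction a s alpha m n ha Hs Hf Hm Hn).
unfold secular_map in H; apply secular_iff in Em, En; rewrite <- Em, <- En in H.
transitivity ((m - n) + n)%C; [ring | ].
rewrite (Cmod_eq_0 (m - n)); [ring | ].
assert (P := Cmod_ge_0 (m - n)); lra.
Qed.

(** The root is merely chosen, separately for each [alpha], and is arbitrary where no root exists.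
    Its regularity is recovered afterwards from [branch_spec] and the estimates on the disk. *)
Definition branch (a : R) (s alpha : C) : C :=
  epsilon (inhabits (RtoC 0)) (fun m => Cmod (m + alpha) <= 1 /\ secular a s alpha m).

Lemma branch_spec (a : R) (s alpha : C) : 0 < a -> unit_sign s -> far a alpha ->
  Cmod (branch a s alpha + alpha) <= 1 /\ secular a s alpha (branch a s alpha).
Proof.
intros ha Hs Hf; unfold branch; apply epsilon_spec; now apply secular_root_exists.
Qed.

(* Subtracting the secular equations at [alpha] and [alpha0] gives
   [D h = - (1 + s E0) k + O(k ^ 2)] for the increments [h] of the root and [k] of [alpha]. *)
Lemma branch_expansion (a : R) (s alpha0 : C) : 0 < a -> unit_sign s -> far a alpha0 ->
  exists (d : C) (K : R), forall alpha, far a alpha -> Cmod (alpha - alpha0) <= 1 ->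
    Cmod (branch a s alpha - branch a s alpha0) <= 3 * Cmod (alpha - alpha0) /\
    Cmod (branch a s alpha - branch a s alpha0 - d * (alpha - alpha0))
      <= K * Cmod (alpha - alpha0) ^ 2.
Proof.
intros ha Hs Hf0.
destruct (branch_spec a s alpha0 ha Hs Hf0) as [Hm0 Em0].
set (m0 := branch a s alpha0) in *.
destruct (far_bounds a alpha0 ha Hf0) as [[t0 t1] [B1 B2]].
assert (L := lip_ge a ha); assert (p0 := Cmod_ge_0 alpha0).
set (E0 := cexp (- (2 * a) * m0)).
assert (e0 : Cmod E0 <= tail a alpha0) by now apply decay_in_disk.
assert (e0p : 0 <= Cmod E0) by apply Cmod_ge_0.
assert (N0 : Cmod (m0 - alpha0) <= 2 * Cmod alpha0 + 1) by now apply Cmod_minus_disk.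
assert (N0p := Cmod_ge_0 (m0 - alpha0)).
assert (NE : Cmod (m0 - alpha0) * Cmod E0 <= (2 * Cmod alpha0 + 1) * tail a alpha0).
{ apply Rmult_le_compat; assumption. }
assert (NEp : 0 <= Cmod (m0 - alpha0) * Cmod E0) by now apply Rmult_le_pos.
assert (NEL : Cmod E0 + Cmod (m0 - alpha0) * Cmod E0 * lip a <= 1 / 4).
{ apply (Rle_trans _ _ _) with (2 := B2); apply Rplus_le_compat; [exact e0 | ].
  apply Rmult_le_compat_r; [lra | exact NE]. }
assert (S1 := Cmod_unit_sign s Hs).
(* [D] is the derivative in [m] of [m + alpha - s (m - alpha) e^(-2 a m)] at the base point, and
   [1 + s E0] the one in [alpha]; the candidate [d] below is the implicit function formula. *)
set (D := (1 - s * E0 + 2 * a * (s * (m0 - alpha0) * E0))%C).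
assert (HD : 1 / 2 <= Cmod D).
{ assert (T : 1 <= Cmod D + (Cmod E0 + 2 * a * (Cmod (m0 - alpha0) * Cmod E0))).
  { rewrite <- Cmod_1 at 1.
    replace (RtoC 1) with (D + (s * E0 + - (2 * a * (s * (m0 - alpha0) * E0))))%C by (unfold D; ring).
    apply (Rle_trans _ _ _ (Cmod_triangle _ _)); apply Rplus_le_compat_l.
    apply (Rle_trans _ _ _ (Cmod_triangle _ _)).
    rewrite Cmod_opp, !Cmod_mult, S1, !Cmod_R, !Rabs_pos_eq by lra; right; ring. }
  assert (2 * a * (Cmod (m0 - alpha0) * Cmod E0) <= Cmod (m0 - alpha0) * Cmod E0 * lip a) by nra.
  lra. }
assert (D0 : D <> 0) by (apply Cmod_gt_0; lra).
set (K1 := 16 * a ^ 2 * exp (6 * a)).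
assert (K1p : 0 <= K1) by (assert (H := exp_pos (6 * a)); unfold K1; nra).
(* With [|h| <= 3 |k|], the term [(h - k) (E - E0)] costs [4 * 3 * lip] and the Taylor remainder
   costs [3 ^ 2 K1]; the factor 2 in the witness is the bound on [1 / |D|]. *)
set (K2 := 12 * lip a + 9 * ((2 * Cmod alpha0 + 1) * K1)).
exists (- ((1 + s * E0) / D))%C, (2 * K2).
intros alpha Hf Hk.
destruct (branch_spec a s alpha ha Hs Hf) as [Hm Em].
set (m := branch a s alpha) in *.
destruct (far_bounds a alpha ha Hf) as [[t0' t1'] _].
set (E := cexp (- (2 * a) * m)).
assert (e1 : Cmod E <= tail a alpha) by now apply decay_in_disk.
set (h := (m - m0)%C); set (k := (alpha - alpha0)%C) in *.
(* Each root is within 1 of its centre and the centres are at most 1 apart: hence the radius 3 in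
   [lip]. *)
assert (h3 : Cmod h <= 3).
{ replace h with ((m + alpha) + - (m0 + alpha0) + - k)%C by (unfold h, k; ring).
  apply (Rle_trans _ _ _ (Cmod_triangle _ _)); rewrite Cmod_opp.
  assert (H := Cmod_triangle (m + alpha) (- (m0 + alpha0))); rewrite Cmod_opp in H; lra. }
assert (hp := Cmod_ge_0 h); assert (kp := Cmod_ge_0 k).
assert (EL : Cmod (E - E0) <= Cmod E0 * lip a * Cmod h) by now apply decay_lipschitz.
assert (ET : Cmod (E - E0 + 2 * a * E0 * h) <= Cmod E0 * K1 * Cmod h ^ 2) by now apply decay_taylor.
unfold secular in Em, Em0; fold E in Em; fold E0 in Em0.
assert (Ih : h = (- k * (1 + s * E) + s * h * E + s * ((m0 - alpha0) * (E - E0)))%C).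
{ replace h with ((m + alpha) - (m0 + alpha0) - k)%C at 1 by (unfold h, k; ring).
  rewrite Em, Em0; unfold h, k; ring. }
assert (Lh : Cmod h <= 3 * Cmod k).
{ assert (T : Cmod h <= Cmod k * (1 + Cmod E) + Cmod h * Cmod E + Cmod (m0 - alpha0) * Cmod (E - E0)).
  { rewrite Ih at 1.
    apply (Rle_trans _ _ _ (Cmod_triangle _ _)), Rplus_le_compat.
    - apply (Rle_trans _ _ _ (Cmod_triangle _ _)), Rplus_le_compat.
      + rewrite Cmod_mult, Cmod_opp; apply Rmult_le_compat_l; [exact kp | ].
        apply (Rle_trans _ _ _ (Cmod_triangle _ _)); rewrite Cmod_1, Cmod_mult, S1; lra.
      + rewrite !Cmod_mult, S1; lra.
    - rewrite !Cmod_mult, S1; lra. }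
  assert (T2 : Cmod (m0 - alpha0) * Cmod (E - E0) <= (Cmod (m0 - alpha0) * Cmod E0 * lip a) * Cmod h).
  { replace (_ * Cmod h) with (Cmod (m0 - alpha0) * (Cmod E0 * lip a * Cmod h)) by ring.
    now apply Rmult_le_compat_l. }
  assert (T3 : Cmod (m0 - alpha0) * Cmod E0 * lip a * Cmod h <= 1 / 4 * Cmod h)
    by (apply Rmult_le_compat_r; lra).
  assert (ep := Cmod_ge_0 E).
  assert (Cmod k * (1 + Cmod E) <= Cmod k * (5 / 4)) by (apply Rmult_le_compat_l; lra).
  assert (Cmod h * Cmod E <= Cmod h * (1 / 4)) by (apply Rmult_le_compat_l; lra).
  lra. }
split; [exact Lh | ].
set (r := (s * (h - k) * (E - E0) + s * (m0 - alpha0) * (E - E0 + 2 * a * E0 * h))%C).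
assert (Ir : (D * h + (1 + s * E0) * k = r)%C).
{ unfold r, D.
  transitivity (h + (- s * E0 * h + 2 * a * (s * (m0 - alpha0) * E0) * h + (1 + s * E0) * k))%C; [ring | ].
  rewrite Ih at 1; ring. }
assert (Br : Cmod r <= K2 * Cmod k ^ 2).
{ assert (h2 : Cmod h ^ 2 <= 9 * Cmod k ^ 2) by nra.
  assert (EL' : Cmod (E - E0) <= lip a * (3 * Cmod k)).
  { apply (Rle_trans _ _ _ EL).
    apply Rmult_le_compat; try assumption; [apply Rmult_le_pos; lra | ].
    rewrite <- (Rmult_1_l (lip a)) at 2; apply Rmult_le_compat_r; lra. }
  assert (ET' : Cmod (E - E0 + 2 * a * E0 * h) <= K1 * (9 * Cmod k ^ 2)).
  { apply (Rle_trans _ _ _ ET).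
    apply Rmult_le_compat; try assumption; [now apply Rmult_le_pos | nra | ].
    rewrite <- (Rmult_1_l K1) at 2; apply Rmult_le_compat_r; lra. }
  assert (hk : Cmod (h - k) <= 4 * Cmod k).
  { apply (Rle_trans _ _ _ (Cmod_triangle _ _)); rewrite Cmod_opp; lra. }
  apply (Rle_trans _ _ _ (Cmod_triangle _ _)); rewrite !Cmod_mult, S1, !Rmult_1_l.
  unfold K2; replace (_ * Cmod k ^ 2) with ((4 * Cmod k) * (lip a * (3 * Cmod k))
    + (2 * Cmod alpha0 + 1) * (K1 * (9 * Cmod k ^ 2))) by ring.
  apply Rplus_le_compat; apply Rmult_le_compat; try apply Cmod_ge_0; assumption. }
replace (h - - ((1 + s * E0) / D) * k)%C with (r / D)%C.
2: { rewrite <- Ir; field; exact D0. }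
rewrite Cmod_div by exact D0.
apply (Rmult_le_reg_r (Cmod D)); [lra | ].
unfold Rdiv; rewrite Rmult_assoc, Rinv_l, Rmult_1_r by lra.
assert (0 <= K2 * Cmod k ^ 2) by (assert (H := Cmod_ge_0 r); lra).
nra.
Qed.

Lemma is_derive_of_quadratic (f : C -> C) (z0 l : C) (K r : R) : 0 < r ->
  (forall z, Cmod (z - z0) < r -> Cmod (f z - f z0 - l * (z - z0)) <= K * Cmod (z - z0) ^ 2) ->
  is_derive (K := C_AbsRing) (V := C_NormedModule) f z0 l.
Proof.
intros hr H; split; [apply is_linear_scal_l | ].
intros x Hx; apply (is_filter_lim_locally_unique (V := AbsRing_NormedModule C_AbsRing)) in Hx; subst x.
intros eps; assert (ep := cond_pos eps).
assert (Kp : 0 < Rabs K + 1) by (assert (P := Rabs_pos K); lra).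
assert (dp : 0 < Rmin r (eps / (Rabs K + 1))).
{ apply Rmin_pos; [exact hr | now apply Rdiv_lt_0_compat]. }
exists (mkposreal _ dp); intros z Hz.
change (Cmod (f z - f z0 - (z - z0) * l) <= eps * Cmod (z - z0)).
change (Cmod (z - z0) < Rmin r (eps / (Rabs K + 1))) in Hz.
assert (Z1 := Rlt_le_trans _ _ _ Hz (Rmin_l _ _)); assert (Z2 := Rlt_le_trans _ _ _ Hz (Rmin_r _ _)).
rewrite (Cmult_comm (z - z0)).
apply (Rle_trans _ _ _ (H z Z1)).
assert (P := Cmod_ge_0 (z - z0)).
assert (Q : (Rabs K + 1) * Cmod (z - z0) <= eps).
{ apply (Rmult_lt_compat_l (Rabs K + 1)) in Z2; [ | exact Kp].
  replace ((Rabs K + 1) * (eps / (Rabs K + 1))) with (pos eps) in Z2 by (field; lra); lra. }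
assert (K <= Rabs K) by apply Rle_abs.
replace (K * Cmod (z - z0) ^ 2) with (K * Cmod (z - z0) * Cmod (z - z0)) by ring.
apply Rmult_le_compat_r; [exact P | nra].
Qed.

Lemma ex_derive_branch_sqr (a : R) (s alpha0 : C) (r : R) : 0 < a -> unit_sign s -> 0 < r ->
  (forall alpha, Cmod (alpha - alpha0) < r -> far a alpha) ->
  ex_derive (K := C_AbsRing) (V := C_NormedModule)
    (fun alpha => (- (branch a s alpha * branch a s alpha))%C) alpha0.
Proof.
intros ha Hs hr Hf.
assert (Hf0 : far a alpha0).
{ apply Hf; replace (alpha0 - alpha0)%C with (RtoC 0) by ring; now rewrite Cmod_0. }
destruct (branch_expansion a s alpha0 ha Hs Hf0) as [d [K HK]].
set (m0 := branch a s alpha0) in *.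
exists (- (2 * m0 * d))%C.
(* From [m ^ 2 - m0 ^ 2 = 2 m0 (m - m0) + (m - m0) ^ 2]; the 9 is the square of the Lipschitz
   constant of the branch. *)
apply (is_derive_of_quadratic _ alpha0 _ (2 * Cmod m0 * K + 9) (Rmin r 1)).
{ apply Rmin_pos; lra. }
intros alpha Ha.
assert (Hr := Rlt_le_trans _ _ _ Ha (Rmin_l _ _)); assert (H1 := Rlt_le_trans _ _ _ Ha (Rmin_r _ _)).
destruct (HK alpha (Hf alpha Hr) ltac:(lra)) as [A1 A2].
fold m0; set (m := branch a s alpha) in *; set (k := (alpha - alpha0)%C) in *.
replace (_ - _)%C with (- (2 * m0 * (m - m0 - d * k)) + - ((m - m0) * (m - m0)))%C by ring.
apply (Rle_trans _ _ _ (Cmod_triangle _ _)).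
rewrite !Cmod_opp, !Cmod_mult, Cmod_R, (Rabs_pos_eq 2) by lra.
rewrite Rmult_plus_distr_r; apply Rplus_le_compat.
- rewrite (Rmult_assoc _ K); apply Rmult_le_compat_l; [ | exact A2].
  assert (P := Cmod_ge_0 m0); lra.
- replace (9 * Cmod k ^ 2) with ((3 * Cmod k) * (3 * Cmod k)) by ring.
  apply Rmult_le_compat; try apply Cmod_ge_0; assumption.
Qed.

(** * Divergent eigenvalues *)

Definition branch_eigenvalue (a : R) (s alpha : C) : C :=
  (- (branch a s alpha * branch a s alpha))%C.

Lemma unit_sign_1 : unit_sign 1.
Proof. now left. Qed.

Lemma unit_sign_m1 : unit_sign (- (1)).
Proof. now right. Qed.

(** Completeness: a large eigenvalue off the sector comes from a secular root, which
    [secular_root_near] places in the disk around [- alpha], where the root for its sign is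
    unique. *)
Lemma eigenvalue_is_branch (a theta : R) : 0 < a -> 0 < theta <= PI ->
  exists M : R, forall alpha lambda : C, far a alpha -> M < Cmod lambda ->
    ~ sector_plus theta lambda -> robin_eigenvalue a alpha lambda ->
    exists s : C, unit_sign s /\ lambda = branch_eigenvalue a s alpha.
Proof.
intros ha Ht; destruct (half_sin_bounds theta Ht) as [kp _].
destruct (secular_root_near a (half_sin theta) ha kp) as [M HM].
exists (M * M); intros alpha lambda Hf LM ns HE.
assert (nz : lambda <> 0).
{ intros E; rewrite E, Cmod_0 in LM; nra. }
destruct (root_outside_sector theta lambda Ht nz ns) as [m [-> [Rm Km]]].
destruct (secular_of_robin_eigenvalue a alpha m ha Rm HE) as [s [Hs Sm]].
exists s; split; [exact Hs | ]; unfold branch_eigenvalue; do 2 f_equal.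
all: destruct (branch_spec a s alpha ha Hs Hf) as [Hb Sb].
all: apply (secular_root_unique a s alpha m (branch a s alpha)); trivial.
all: apply (HM s alpha m); trivial.
all: rewrite Cmod_opp, Cmod_mult in LM; assert (P := Cmod_ge_0 m); nra.
Qed.

Lemma branch_eigenvalue_in_sector (a phi theta : R) : 0 < a -> 0 < phi < PI / 2 ->
  0 < theta < PI - 2 * phi ->
  exists M : R, 1 <= M /\ forall s alpha : C, unit_sign s -> sector_minus phi alpha -> M < Cmod alpha ->
    far a alpha /\ 0 < Re (branch a s alpha) /\
    half_sin theta * Cmod (branch a s alpha) <= Re (branch a s alpha) /\
    Cmod alpha - 1 <= Cmod (branch a s alpha).
Proof.
intros ha Hp Ht.
assert (kc := half_sin_lt_cos phi theta Hp Ht).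
destruct (half_sin_bounds theta ltac:(lra)) as [kp _].
set (k := half_sin theta) in *; set (c := cos phi) in *.
destruct (far_in_sector a c ha ltac:(lra)) as [M0 HM0].
(* In the disk [Re m >= c |alpha| - 1] and [|m| <= |alpha| + 1], so [k |m| <= Re m] once
   [(c - k) |alpha| >= 1 + k]. *)
exists (Rmax (Rmax 1 M0) ((1 + k) / (c - k))); split.
{ apply (Rle_trans _ _ _ (Rmax_l 1 M0)), Rmax_l. }
intros s alpha Hs Ha LM.
assert (L1 := Rle_lt_trans _ _ _ (Rmax_l _ _) LM); assert (L2 := Rle_lt_trans _ _ _ (Rmax_r _ _) LM).
apply sector_minus_iff in Ha; [ | lra]; destruct Ha as [_ Ha]; fold c in Ha.
assert (Hf : far a alpha).
{ apply HM0; [lra | exact (Rle_lt_trans _ _ _ (Rmax_r 1 M0) L1)]. }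
destruct (branch_spec a s alpha ha Hs Hf) as [Hb _].
set (m := branch a s alpha) in *.
assert (L3 : 1 + k < (c - k) * Cmod alpha).
{ apply (Rmult_lt_compat_l (c - k)) in L2; [ | lra].
  replace ((c - k) * ((1 + k) / (c - k))) with (1 + k) in L2 by (field; lra); exact L2. }
assert (R1 : Re (- alpha) - 1 <= Re m).
{ assert (B := Re_bounds (m + alpha)); unfold Re, Cplus, Copp in *; simpl in *; lra. }
assert (U : Cmod m <= Cmod alpha + 1).
{ replace m with ((m + alpha) + - alpha)%C by ring.
  apply (Rle_trans _ _ _ (Cmod_triangle _ _)); rewrite Cmod_opp; lra. }
assert (V : Cmod alpha - 1 <= Cmod m).
{ assert (T := Cmod_triangle (m + alpha) (- m)); rewrite Cmod_opp in T.
  replace (m + alpha + - m)%C with alpha in T by ring; lra. }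
assert (P := Cmod_ge_0 alpha).
split; [exact Hf | repeat split; nra].
Qed.

Lemma sector_minus_open (phi M : R) (alpha0 : C) : 0 < phi < PI / 2 -> 0 <= M ->
  sector_minus phi alpha0 -> M < Cmod alpha0 ->
  exists r : R, 0 < r /\ forall alpha : C, Cmod (alpha - alpha0) < r ->
    sector_minus phi alpha /\ M < Cmod alpha.
Proof.
intros Hp HM Ha LM; apply sector_minus_iff in Ha; [ | lra]; destruct Ha as [_ Ha].
assert (c0 : 0 < cos phi) by (apply cos_gt_0; lra).
assert (c1 := COS_bound phi).
set (c := cos phi) in *.
(* A displacement [d] shrinks the margin [Re (- alpha) - c |alpha|] by at most
   [(1 + c) d <= 2 d]. *)
exists (Rmin ((Re (- alpha0) - Cmod alpha0 * c) / 2) (Cmod alpha0 - M)); split.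
{ apply Rmin_pos; lra. }
intros alpha Hr.
assert (H1 := Rlt_le_trans _ _ _ Hr (Rmin_l _ _)); assert (H2 := Rlt_le_trans _ _ _ Hr (Rmin_r _ _)).
set (d := Cmod (alpha - alpha0)) in *.
assert (d0 : 0 <= d) by apply Cmod_ge_0.
assert (B := Re_bounds (alpha - alpha0)); fold d in B.
assert (T1 := Cmod_triangle_inv alpha alpha0); fold d in T1.
assert (T2 := Cmod_triangle_inv alpha0 alpha); rewrite Cmod_minus_sym in T2; fold d in T2.
assert (L : M < Cmod alpha) by lra.
split; [ | exact L].
apply sector_minus_iff; [lra | split].
- intros E; rewrite E, Cmod_0 in L; lra.
- fold c; unfold Re, Cminus, Cplus, Copp in *; simpl in *; nra.
Qed.

(** Complex differentiability uses neighbourhoods given by the modulus, [divergent_eigenvalue] those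
    of the product of two real lines; [locally_C] identifies them. *)
Lemma continuous_of_C_derive (f : C -> C) (z : C) :
  ex_derive (K := C_AbsRing) (V := C_NormedModule) f z ->
  filterlim f (locally z) (locally (f z)).
Proof.
intros H; apply ex_derive_continuous in H.
intros P HP; apply locally_C; exact (H P HP).
Qed.

Lemma branch_eigenvalue_derive (a phi theta : R) (s : C) : 0 < a -> 0 < phi < PI / 2 ->
  0 < theta < PI - 2 * phi -> unit_sign s ->
  at_infinity (sector_minus phi) (fun alpha =>
    ex_derive (K := C_AbsRing) (V := C_NormedModule) (branch_eigenvalue a s) alpha).
Proof.
intros ha Hp Ht Hs.
destruct (branch_eigenvalue_in_sector a phi theta ha Hp Ht) as [M [M1 HM]].
exists M; intros alpha Ha LM.
destruct (sector_minus_open phi M alpha Hp ltac:(lra) Ha LM) as [r [hr Hr]].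
apply (ex_derive_branch_sqr a s alpha r ha Hs hr).
intros z Hz; destruct (Hr z Hz) as [Sz Lz]; now apply (HM s z).
Qed.

Lemma branch_eigenvalue_divergent (a phi theta : R) (s : C) : 0 < a -> 0 < phi < PI / 2 ->
  0 < theta < PI - 2 * phi -> unit_sign s ->
  divergent_eigenvalue a (sector_minus phi) (fun z => ~ sector_plus theta z) (branch_eigenvalue a s).
Proof.
intros ha Hp Ht Hs.
destruct (branch_eigenvalue_in_sector a phi theta ha Hp Ht) as [M [M1 HM]].
split.
- exists M; intros alpha Ha LM; destruct (HM s alpha Hs Ha LM) as [Hf [Rm _]].
  apply (robin_eigenvalue_of_secular a s); trivial; now apply branch_spec.
- exists M; intros alpha Ha LM; destruct (HM s alpha Hs Ha LM) as [_ [_ [Km _]]].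
  apply square_outside_sector; [lra | exact Km].
- generalize (branch_eigenvalue_derive a phi theta s ha Hp Ht Hs); apply filter_imp.
  intros alpha D; apply (filterlim_filter_le_1 (F := locally alpha)).
  + intros P; unfold within; apply filter_imp; auto.
  + now apply continuous_of_C_derive.
- intros P [N HN].
  exists (Rmax M (Rabs N + 2)); intros alpha Ha LM; apply HN.
  assert (L1 := Rle_lt_trans _ _ _ (Rmax_l _ _) LM); assert (L2 := Rle_lt_trans _ _ _ (Rmax_r _ _) LM).
  destruct (HM s alpha Hs Ha L1) as [_ [_ [_ V]]].
  unfold branch_eigenvalue; rewrite Cmod_opp, Cmod_mult.
  assert (N <= Rabs N) by apply Rle_abs; assert (0 <= Rabs N) by apply Rabs_pos; nra.
Qed.

(** Equal squares with positive real parts give equal roots. A common root of both secular equations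
    satisfies [m + alpha = 0] and [m - alpha = 0], so it would be 0. *)
Lemma branch_eigenvalue_neq (a phi theta : R) : 0 < a -> 0 < phi < PI / 2 ->
  0 < theta < PI - 2 * phi ->
  at_infinity (sector_minus phi)
    (fun alpha => branch_eigenvalue a 1 alpha <> branch_eigenvalue a (- (1)) alpha).
Proof.
intros ha Hp Ht.
destruct (branch_eigenvalue_in_sector a phi theta ha Hp Ht) as [M [M1 HM]].
exists M; intros alpha Ha LM E.
destruct (HM _ alpha unit_sign_1 Ha LM) as [Hf [R1 _]].
destruct (HM _ alpha unit_sign_m1 Ha LM) as [_ [R2 _]].
destruct (branch_spec a _ alpha ha unit_sign_1 Hf) as [_ S1].
destruct (branch_spec a _ alpha ha unit_sign_m1 Hf) as [_ S2].
unfold branch_eigenvalue in E.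
set (m := branch a 1 alpha) in *; set (n := branch a (- (1)) alpha) in *.
assert (F : ((m - n) * (m + n) = 0)%C).
{ transitivity (- (n * n) - - (m * m))%C; [ | rewrite E]; ring. }
assert (nz : forall z, 0 < Re z -> z <> 0) by (intros z Hz ->; simpl in Hz; lra).
assert (mn : m = n).
{ destruct (Ceq_dec (m - n) 0) as [Z | Z].
  - transitivity ((m - n) + n)%C; [ring | rewrite Z; ring].
  - exfalso; apply (Cmult_neq_0 (m - n) (m + n)); auto.
    apply nz; unfold Re, Cplus in *; simpl in *; lra. }
rewrite <- mn in S2; unfold secular in S1, S2.
assert (Z1 : (2 * (m + alpha) = 0)%C).
{ transitivity ((m + alpha) + (m + alpha))%C; [ring | rewrite S1 at 1; rewrite S2; ring]. }
assert (two : RtoC 2 <> 0) by (intros H; apply RtoC_inj in H; lra).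
assert (Z2 : (m + alpha = 0)%C).
{ transitivity (2 * (m + alpha) / 2)%C; [field; exact two | rewrite Z1; field; exact two]. }
assert (Z3 : ((m - alpha) * cexp (- (2 * a) * m) = 0)%C).
{ transitivity (m + alpha)%C; [rewrite S1; ring | exact Z2]. }
apply (Cmult_neq_0 (m - alpha) (cexp (- (2 * a) * m))); trivial; [ | apply cexp_neq_0].
replace (m - alpha)%C with (2 * m - (m + alpha))%C by ring.
rewrite Z2; replace (2 * m - 0)%C with (2 * m)%C by ring.
apply Cmult_neq_0; auto.
Qed.

Lemma branch_eigenvalue_asymptotics (a phi theta : R) (s : C) : 0 < a -> 0 < phi < PI / 2 ->
  0 < theta < PI - 2 * phi -> unit_sign s ->
  bigO_at_infinity (sector_minus phi)
    (fun alpha => Cminus (branch_eigenvalue a s alpha) (Copp (Cmult alpha alpha)))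
    (fun alpha => Cmod alpha ^ 2 * exp (2 * a * Re alpha)).
Proof.
intros ha Hp Ht Hs.
destruct (branch_eigenvalue_in_sector a phi theta ha Hp Ht) as [M [M1 HM]].
(* The error is [- s (m - alpha) ^ 2 e^(-2 a m)]: here [|m - alpha| <= 3 |alpha|], and [tail] is
   [e^(2 a)] times [e^(2 a Re alpha)]. *)
exists (9 * exp (2 * a)), M; intros alpha Ha LM.
destruct (HM s alpha Hs Ha LM) as [Hf _].
destruct (branch_spec a s alpha ha Hs Hf) as [Hb Sb].
unfold branch_eigenvalue; set (m := branch a s alpha) in *; unfold secular in Sb.
replace (- (m * m) - - (alpha * alpha))%C with (- ((m + alpha) * (m - alpha)))%C by ring.
rewrite Sb, Cmod_opp, !Cmod_mult, (Cmod_unit_sign s Hs), Rmult_1_l.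
assert (N := Cmod_minus_disk alpha m Hb); assert (D := decay_in_disk a alpha m ha Hb).
assert (Np := Cmod_ge_0 (m - alpha)); assert (Dp := Cmod_ge_0 (cexp (- (2 * a) * m))).
assert (ep := exp_pos (2 * a * Re alpha)).
rewrite Rabs_pos_eq by nra.
replace (9 * exp (2 * a) * (Cmod alpha ^ 2 * exp (2 * a * Re alpha)))
  with ((3 * Cmod alpha) * tail a alpha * (3 * Cmod alpha)).
2: { unfold tail; rewrite Rmult_plus_distr_l, exp_plus, Rmult_1_r; ring. }
assert (N3 : Cmod (m - alpha) <= 3 * Cmod alpha) by lra.
apply Rmult_le_compat; trivial; [now apply Rmult_le_pos | now apply Rmult_le_compat].
Qed.

(** The alternative is pointwise: along a sequence or a disconnected set, [lambda] may alternate
    between the branches. *)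
Lemma divergent_eigenvalue_is_branch (a phi theta : R) (A : C -> Prop) (lambda : C -> C) :
  0 < a -> 0 < phi < PI / 2 -> 0 < theta < PI - 2 * phi ->
  (forall alpha : C, A alpha -> sector_minus phi alpha) ->
  divergent_eigenvalue a A (fun z => ~ sector_plus theta z) lambda ->
  at_infinity A (fun alpha =>
    lambda alpha = branch_eigenvalue a 1 alpha \/ lambda alpha = branch_eigenvalue a (- (1)) alpha).
Proof.
intros ha Hp Ht HA [HE HS _ HI].
destruct (branch_eigenvalue_in_sector a phi theta ha Hp Ht) as [M [M1 HM]].
destruct (eigenvalue_is_branch a theta ha ltac:(lra)) as [N HN].
assert (HI' : at_infinity A (fun alpha => N < Cmod (lambda alpha))) by (apply HI; now exists N).
assert (HF : at_infinity A (far a)).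
{ exists M; intros alpha Ha LM; now apply (HM 1 alpha unit_sign_1 (HA _ Ha)). }
generalize (filter_and _ _ (filter_and _ _ HE HS) (filter_and _ _ HI' HF)).
apply filter_imp; intros alpha [[E S] [I F]].
destruct (HN alpha (lambda alpha) F I S E) as [s [[-> | ->] H]]; auto.
Qed.

(** * Connectedness of the truncated sector and selection of a branch *)

Lemma sign_constant_on_segment (S : C -> Prop) (h : C -> R) (p q : C) :
  (forall t : R, 0 <= t <= 1 -> S (p + t * (q - p))%C) ->
  (forall z, S z -> filterlim h (within S (locally z)) (locally (h z))) ->
  (forall z, S z -> h z <> 0) -> h p < 0 -> h q < 0.
Proof.
intros HS Hc Hn Hp.
destruct (Rlt_le_dec (h q) 0) as [L | L]; [exact L | exfalso].
(* Clamping the parameter to [[0, 1]] extends the segment to a path continuous on the whole line, as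
   the intermediate value theorem is applied to a globally continuous function. *)
set (cl := fun t : R => Rmax 0 (Rmin t 1)).
assert (clB : forall t, 0 <= cl t <= 1).
{ intros t; unfold cl; split; [apply Rmax_l | ].
  apply Rmax_lub; [lra | apply Rmin_r]. }
assert (clL : forall t u, Rabs (cl t - cl u) <= Rabs (t - u)).
{ intros t u; unfold cl, Rmax, Rmin; repeat destruct Rle_dec; unfold Rabs; repeat destruct Rcase_abs; lra. }
assert (cl0 : cl 0 = 0) by (unfold cl; rewrite Rmin_left, Rmax_left; lra).
assert (cl1 : cl 1 = 1) by (unfold cl; rewrite Rmin_left, Rmax_right; lra).
set (g := fun t : R => (p + cl t * (q - p))%C).
assert (G0 : g 0 = p) by (unfold g; rewrite cl0; ring).
assert (G1 : g 1 = q) by (unfold g; rewrite cl1; ring).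
assert (GC : forall t : R, filterlim g (locally t) (locally (g t))).
{ intros t; apply filterlim_Cplus; [apply locally_filter | apply filterlim_const | ].
  apply filterlim_Cmult; [apply locally_filter | | apply filterlim_const].
  apply filterlim_C; [apply locally_filter | split; simpl; [ | apply filterlim_const]].
  intros P [eps HP]; exists eps; intros u Hu; apply HP.
  exact (Rle_lt_trans _ _ _ (clL u t) Hu). }
assert (HC : forall t : R, continuous (fun t => h (g t)) t).
{ intros t; apply (filterlim_comp _ _ _ g h _ (within S (locally (g t)))).
  - intros P HP; unfold filtermap.
    assert (K := GC t _ HP); unfold filtermap in K; revert K; apply filter_imp.
    intros u Hu; apply Hu, HS, clB.
  - apply Hc, HS, clB. }
destruct (IVT_gen_consistent (fun t => h (g t)) 0 1 0 HC) as [t [_ Z]].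
{ rewrite G0, G1, Rmin_left, Rmax_right; lra. }
apply (Hn (g t)); [apply HS, clB | exact Z].
Qed.

(* Two points of the truncated cone are joined by following their rays outwards by the
   factor [1 / cos phi]: the segment between the two end points then avoids the disk. *)
Lemma sign_constant_on_sector (phi M : R) (h : C -> R) (p q : C) : 0 < phi < PI / 2 -> 0 <= M ->
  let S := fun alpha => sector_minus phi alpha /\ M < Cmod alpha in
  (forall z, S z -> filterlim h (within S (locally z)) (locally (h z))) ->
  (forall z, S z -> h z <> 0) -> S p -> S q -> h p < 0 -> h q < 0.
Proof.
intros Hp HM S Hc Hn Sp Sq Lp.
assert (c0 : 0 < cos phi) by (apply cos_gt_0; lra).
assert (c1 : cos phi <= 1) by apply COS_bound.
assert (SE : forall z, S z <-> Cmod z * cos phi < Re (- z) /\ M < Cmod z).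
{ intros z; unfold S; rewrite sector_minus_iff by lra; split; [tauto | ].
  intros [H1 H2]; repeat split; trivial; intros E; rewrite E, Cmod_0 in H2; lra. }
set (c := cos phi) in *; set (t := / c).
assert (t1 : 1 <= t) by (unfold t; rewrite <- Rinv_1; apply Rinv_le_contravar; lra).
assert (tc : t * c = 1) by (unfold t; field; lra).
assert (Cm : forall (r : R) (z : C), 0 <= r -> Cmod (r * z) = r * Cmod z).
{ intros r z Hr; rewrite Cmod_mult, Cmod_R, Rabs_pos_eq by exact Hr; reflexivity. }
assert (ray : forall z (r : R), S z -> 1 <= r -> S (r * z)%C).
{ intros z r Hz Hr; apply SE; apply SE in Hz; destruct Hz as [H1 H2].
  rewrite Cm by lra.
  replace (Re (- (r * z))) with (r * Re (- z)) by (unfold Re; simpl; ring).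
  split; [rewrite Rmult_assoc; apply Rmult_lt_compat_l; lra | nra]. }
assert (L1 : h (t * p)%C < 0).
{ apply (sign_constant_on_segment S h p); trivial.
  intros u Hu; replace (p + u * (t * p - p))%C with ((1 + u * (t - 1))%R * p)%C.
  - apply ray; [exact Sp | nra].
  - rewrite RtoC_plus, RtoC_mult, RtoC_minus; ring. }
assert (L2 : h (t * q)%C < 0).
{ apply (sign_constant_on_segment S h (t * p)%C); trivial.
  intros u Hu; apply SE in Sp, Sq; apply SE; destruct Sp as [P1 P2], Sq as [Q1 Q2].
  replace (t * p + u * (t * q - t * p))%C with (t * ((1 - u)%R * p + u * q))%C
    by (rewrite RtoC_minus; ring).
  set (w := ((1 - u)%R * p + u * q)%C).
  assert (W1 : Cmod w <= (1 - u) * Cmod p + u * Cmod q).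
  { apply (Rle_trans _ _ _ (Cmod_triangle _ _)); rewrite !Cm by lra; lra. }
  assert (W2 : Re (- w) = (1 - u) * Re (- p) + u * Re (- q)) by (unfold w, Re; simpl; ring).
  (* Convex combinations keep strict inequalities: one of the two weights is at least [1 / 2], hence
     positive. *)
  assert (W3 : ((1 - u) * Cmod p + u * Cmod q) * c < Re (- w)).
  { rewrite W2; destruct (Rle_lt_dec u (1 / 2)); nra. }
  assert (W4 : M < (1 - u) * Cmod p + u * Cmod q).
  { destruct (Rle_lt_dec u (1 / 2)); nra. }
  assert (W5 := Re_bounds (- w)); rewrite Cmod_opp in W5.
  rewrite Cm by lra.
  replace (Re (- (t * w))) with (t * Re (- w)) by (unfold Re; simpl; ring).
  split.
  - rewrite Rmult_assoc; apply Rmult_lt_compat_l; [lra | ].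
    apply Rle_lt_trans with (2 := W3); apply Rmult_le_compat_r; lra.
  - apply Rlt_le_trans with (t * Re (- w)); [ | apply Rmult_le_compat_l; lra].
    apply Rlt_trans with (1 := W4).
    replace (_ + _) with (t * (((1 - u) * Cmod p + u * Cmod q) * c)).
    + apply Rmult_lt_compat_l; lra.
    + transitivity (((1 - u) * Cmod p + u * Cmod q) * (t * c)); [ring | rewrite tc; ring]. }
apply (sign_constant_on_segment S h (t * q)%C); trivial.
intros u Hu; replace (t * q + u * (q - t * q))%C with ((t - u * (t - 1))%R * q)%C.
- apply ray; [exact Sq | nra].
- rewrite RtoC_minus, RtoC_mult, RtoC_minus; ring.
Qed.

Lemma filterlim_Cmod_minus {T : Type} (F : (T -> Prop) -> Prop) {FF : Filter F} (f g : T -> C) (y z : C) :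
  filterlim f F (locally y) -> filterlim g F (locally z) ->
  filterlim (fun t => Cmod (f t - g t)) F (locally (Cmod (y - z))).
Proof.
intros Hf Hg.
apply (filterlim_comp _ _ _ (fun t => (f t - g t)%C) Cmod _ (locally (y - z)%C)).
- apply filterlim_Cplus; [exact FF | exact Hf | ].
  apply (filterlim_comp _ _ _ g Copp _ (locally z)); [exact Hg | ].
  apply (filterlim_opp (V := C_R_NormedModule)).
- apply (filterlim_norm (V := C_NormedModule)).
Qed.

Lemma continuous_selection (phi : R) (lambda l1 l2 : C -> C) : 0 < phi < PI / 2 ->
  let A := sector_minus phi in
  let cont f := at_infinity A (fun alpha =>
    filterlim f (within A (locally alpha)) (locally (f alpha : C))) in
  cont lambda -> cont l1 -> cont l2 ->
  at_infinity A (fun alpha => l1 alpha <> l2 alpha) ->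
  at_infinity A (fun alpha => lambda alpha = l1 alpha \/ lambda alpha = l2 alpha) ->
  at_infinity A (fun alpha => lambda alpha = l1 alpha) \/
  at_infinity A (fun alpha => lambda alpha = l2 alpha).
Proof.
intros Hp A cont C0 C1 C2 N12 Or.
destruct (filter_and _ _ (filter_and _ _ C0 C1) (filter_and _ _ C2 (filter_and _ _ N12 Or)))
  as [M0 HM].
set (M := Rmax 0 M0).
set (S := fun alpha => sector_minus phi alpha /\ M < Cmod alpha).
(* A continuous real function whose sign tells which branch [lambda] follows; it has no zero because
   the branches never meet. *)
set (h := fun alpha => Cmod (lambda alpha - l1 alpha) - Cmod (lambda alpha - l2 alpha)).
assert (HS : forall z, S z -> _) by (intros z [Az Lz];
  exact (HM z Az (Rle_lt_trans _ _ _ (Rmax_r 0 M0) Lz))).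
assert (self : forall z : C, Cmod (z - z) = 0).
{ intros z; replace (z - z)%C with (RtoC 0) by ring; apply Cmod_0. }
assert (apart : forall z, S z -> 0 < Cmod (l1 z - l2 z)).
{ intros z Hz; destruct (HS z Hz) as [_ [_ [N _]]]; apply Cmod_gt_0; intros E; apply N.
  transitivity ((l1 z - l2 z) + l2 z)%C; [ring | rewrite E; ring]. }
assert (neg : forall z, S z -> (h z < 0 /\ lambda z = l1 z) \/ (0 < h z /\ lambda z = l2 z)).
{ intros z Hz; assert (P := apart z Hz); destruct (HS z Hz) as [_ [_ [_ [E | E]]]];
    [left | right]; (split; [ | exact E]); unfold h; rewrite E, self.
  - lra.
  - rewrite (Cmod_minus_sym (l2 z)); lra. }
assert (hc : forall z, S z -> filterlim h (within S (locally z)) (locally (h z))).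
{ intros z Hz; destruct (HS z Hz) as [[D0 D1] [D2 _]].
  apply (filterlim_filter_le_1 (F := within A (locally z))).
  - intros P; unfold within; apply filter_imp; intros u Hu Su; apply Hu, Su.
  - assert (WF : Filter (within A (locally z))) by apply within_filter, locally_filter.
    apply (filterlim_comp_2 (fun u => Cmod (lambda u - l1 u)) (fun u => - Cmod (lambda u - l2 u)) Rplus
      (G := locally (Cmod (lambda z - l1 z))) (H := locally (- Cmod (lambda z - l2 z)))).
    + now apply filterlim_Cmod_minus.
    + apply (filterlim_comp _ _ _ (fun u => Cmod (lambda u - l2 u)) Ropp _
        (locally (Cmod (lambda z - l2 z)))).
      * now apply filterlim_Cmod_minus.
      * apply (filterlim_opp (V := R_NormedModule)).
    + apply (filterlim_plus (V := R_NormedModule)). }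
assert (hn : forall z, S z -> h z <> 0) by (intros z Hz; destruct (neg z Hz); lra).
destruct (classic (exists p, S p /\ h p < 0)) as [[p [Sp Lp]] | No].
- left; exists M; intros z Az Lz; assert (Sz : S z) by now split.
  assert (K := sign_constant_on_sector phi M h p z Hp (Rmax_l _ _) hc hn Sp Sz Lp).
  destruct (neg z Sz) as [[_ E] | [K' _]]; [exact E | lra].
- right; exists M; intros z Az Lz; assert (Sz : S z) by now split.
  destruct (neg z Sz) as [[K E] | [_ E]]; [ | exact E].
  exfalso; apply No; now exists z.
Qed.

(** [secular_root_near] does not assume [far], so it applies here: [|m + alpha| <= 1] gives
    [Re alpha <= 1 - Re m <= 1 - k |m|], which drops below [c] for large [m]. *)
Lemma no_divergent_eigenvalue (a : R) (A : C -> Prop) (c theta : R) (lambda : C -> C) :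
  0 < a -> unbounded A -> (forall alpha : C, A alpha -> c <= Re alpha) -> 0 < theta ->
  ~ divergent_eigenvalue a A (fun z => ~ sector_plus theta z) lambda.
Proof.
intros ha UA HA Ht [HE HS _ HI].
(* The root estimate needs an angle at most [PI]; a value outside [T_theta^+] is also outside the
   smaller sector. *)
set (th := Rmin theta PI).
assert (Hth : 0 < th <= PI).
{ split; [apply Rmin_pos; [exact Ht | apply PI_RGT_0] | apply Rmin_r]. }
destruct (half_sin_bounds th Hth) as [kp _]; set (k := half_sin th) in *.
destruct (secular_root_near a k ha kp) as [M HM].
set (N := Rmax (Rmax 0 M) ((1 - c) / k)).
assert (HI' : at_infinity A (fun alpha => N * N < Cmod (lambda alpha))) by (apply HI; now exists (N * N)).
(* As [A] is unbounded, properties valid at infinity in [A] hold together at some actual [alpha]. *)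
destruct (at_infinity_proper A UA) as [ex _].
destruct (ex _ (filter_and _ _ (filter_and _ _ HE HS) (filter_and _ _ HI'
  (ex_intro _ 0 (fun alpha Ha _ => Ha) : at_infinity A A)))) as [alpha [[E S] [I Aa]]].
assert (Rc := HA alpha Aa).
assert (N0 : 0 <= N) by (apply (Rle_trans _ _ _ (Rmax_l 0 M)), Rmax_l).
assert (NM : M <= N) by (apply (Rle_trans _ _ _ (Rmax_r 0 M)), Rmax_l).
assert (Nc : (1 - c) / k <= N) by apply Rmax_r.
assert (nz : lambda alpha <> 0) by (intros Z; rewrite Z, Cmod_0 in I; nra).
destruct (root_outside_sector th (lambda alpha) Hth nz) as [m [Em [Rm Km]]].
{ intros Hs; apply S; apply (sector_plus_mono th); [apply Rmin_l | exact Hs]. }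
rewrite Em in E, I; rewrite Cmod_opp, Cmod_mult in I; assert (P := Cmod_ge_0 m).
assert (Lm : N < Cmod m) by nra.
destruct (secular_of_robin_eigenvalue a alpha m ha Rm E) as [s [Hs Sm]].
assert (B := HM s alpha m Hs Km ltac:(lra) Sm).
assert (B' := Re_bounds (m + alpha)).
assert (1 - c < k * Cmod m).
{ apply (Rmult_lt_reg_r (/ k)); [now apply Rinv_0_lt_compat | ].
  replace (k * Cmod m * / k) with (Cmod m) by (field; lra); unfold Rdiv in Nc; lra. }
fold k in Km; unfold Re, Cplus in *; simpl in *; lra.
Qed.

Theorem theorem2p4 (a : R) (ha : 0 < a) :
  (forall phi : R, 0 < phi < PI / 2 ->
   forall theta : R, 0 < theta < PI - 2 * phi ->
   exists lambda1 lambda2 : C -> C,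
     (* two divergent eigenvalues, analytic and never equal for large alpha *)
     divergent_eigenvalue a (sector_minus phi)
       (fun z => ~ sector_plus theta z) lambda1 /\
     divergent_eigenvalue a (sector_minus phi)
       (fun z => ~ sector_plus theta z) lambda2 /\
     at_infinity (sector_minus phi)
       (fun alpha => ex_derive (K := C_AbsRing) (V := C_NormedModule) lambda1 alpha) /\
     at_infinity (sector_minus phi)
       (fun alpha => ex_derive (K := C_AbsRing) (V := C_NormedModule) lambda2 alpha) /\
     at_infinity (sector_minus phi)
       (fun alpha => lambda1 alpha <> lambda2 alpha) /\
     (* there is no third one in the sector *)
     (forall lambda : C -> C,
        divergent_eigenvalue a (sector_minus phi)
          (fun z => ~ sector_plus theta z) lambda ->
        at_infinity (sector_minus phi) (fun alpha => lambda alpha = lambda1 alpha) \/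
        at_infinity (sector_minus phi) (fun alpha => lambda alpha = lambda2 alpha)) /\
     (* nor along any curve, sequence, etc. in it *)
     (forall (A : C -> Prop) (lambda : C -> C),
        (forall alpha : C, A alpha -> sector_minus phi alpha) -> unbounded A ->
        divergent_eigenvalue a A (fun z => ~ sector_plus theta z) lambda ->
        at_infinity A (fun alpha =>
          lambda alpha = lambda1 alpha \/ lambda alpha = lambda2 alpha)) /\
     bigO_at_infinity (sector_minus phi)
       (fun alpha => Cminus (lambda1 alpha) (Copp (Cmult alpha alpha)))
       (fun alpha => Cmod alpha ^ 2 * exp (2 * a * Re alpha)) /\
     bigO_at_infinity (sector_minus phi)
       (fun alpha => Cminus (lambda2 alpha) (Copp (Cmult alpha alpha)))
       (fun alpha => Cmod alpha ^ 2 * exp (2 * a * Re alpha))) /\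
  (forall (A : C -> Prop) (c : R),
     unbounded A -> (forall alpha : C, A alpha -> c <= Re alpha) ->
   forall theta : R, 0 < theta ->
     ~ exists lambda : C -> C,
         divergent_eigenvalue a A (fun z => ~ sector_plus theta z) lambda).
Proof.
split.
- intros phi Hp theta Ht.
  exists (branch_eigenvalue a 1), (branch_eigenvalue a (- (1))).
  assert (D1 := branch_eigenvalue_divergent a phi theta _ ha Hp Ht unit_sign_1).
  assert (D2 := branch_eigenvalue_divergent a phi theta _ ha Hp Ht unit_sign_m1).
  assert (N12 := branch_eigenvalue_neq a phi theta ha Hp Ht).
  split; [exact D1 | split; [exact D2 | ]].
  split; [exact (branch_eigenvalue_derive a phi theta _ ha Hp Ht unit_sign_1) | ].
  split; [exact (branch_eigenvalue_derive a phi theta _ ha Hp Ht unit_sign_m1) | ].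
  split; [exact N12 | ].
  split; [ | split; [ | split]].
  + intros lambda D; apply continuous_selection; trivial.
    * exact (divergent_continuous _ _ _ _ D).
    * exact (divergent_continuous _ _ _ _ D1).
    * exact (divergent_continuous _ _ _ _ D2).
    * now apply (divergent_eigenvalue_is_branch a phi theta).
  + intros A lambda HA _ D; now apply (divergent_eigenvalue_is_branch a phi theta).
  + exact (branch_eigenvalue_asymptotics a phi theta _ ha Hp Ht unit_sign_1).
  + exact (branch_eigenvalue_asymptotics a phi theta _ ha Hp Ht unit_sign_m1).
- intros A c UA HA theta Ht [lambda D].
  exact (no_divergent_eigenvalue a A c theta lambda ha UA HA Ht D).
Qed.
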